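(* Let $K$ be a convex body in $\mathbb{R}^n$ that is symmetric in the sense of Davies. Then the minimum volume circumscribed ellipsoid $\mathrm{CE}(K)=E(X,c)$ has center $c=\mathrm{cg}(K)$ and $$X^{-1}=n\int_G A_g^{-1}(x-c)(x-c)^TA_g^{-T}\,d\mu(g),$$ where $x\in\mathrm{ext}(K)$ is an arbitrary point, $G=\mathrm{Aut}(K)$, $\mu$ is the Haar probability measure on $G$, and $A_g$ denotes the linear part of $g\in G$.
   Context: A convex body is a compact convex set with nonempty interior. For a convex body $K\subset\mathbb{R}^n$, $\mathrm{Aut}(K)$ is the group of affine transformations $T(x)=a+Ax$ of $\mathbb{R}^n$ with $T(K)=K$; it is a compact Lie group. For $g\in\mathrm{Aut}(K)$, $g(x)=a_g+A_gx$, the matrix $A_g$ is its linear part, and $A_g^{-T}=(A_g^{-1})^T$. $\mathrm{ext}(K)$ is the set of extreme points of $K$. $K$ is symmetric in the sense of Davies if $\mathrm{Aut}(K)$ acts transitively on $\mathrm{ext}(K)$. $\mathrm{cg}(K)=\frac{1}{\mathrm{vol}(K)}\int_K x\,dx$ is the center of gravity of $K$. For a symmetric positive definite matrix $X$ and $c\in\mathbb{R}^n$, $E(X,c)=\{x\in\mathbb{R}^n:\langle X(x-c),x-c\rangle\le1\}$; $\mathrm{CE}(K)$ is the unique ellipsoid of minimum volume containing $K$. *)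

(* Defs.v *)
From HB Require Import structures.
From mathcomp Require Import all_boot all_order all_algebra.
From mathcomp Require Import all_classical all_reals all_analysis.
From mathcomp Require Import measurable_realfun.

Set Implicit Arguments.
Unset Strict Implicit.
Unset Printing Implicit Defensive.

Import Order.TTheory GRing.Theory Num.Theory.
Import numFieldNormedType.Exports.

Local Open Scope classical_set_scope.
Local Open Scope ring_scope.

Notation Borel T := (g_sigma_algebraType (@open T)).

(* R^n is 'cV[R]_n; its topology is that of the sup norm. *)

Section BorelColumns.
Variable R : realType.

Lemma open_cV_rat_balls n (U : set 'cV[R]_n) : open U ->
  U = \bigcup_(p in [set p : 'cV[rat]_n * rat |
                      ball (map_mx ratr p.1 : 'cV[R]_n) (ratr p.2) `<=` U])
        ball (map_mx ratr p.1 : 'cV[R]_n) (ratr p.2).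
Proof.
move=> oU; apply/seteqP; split=> [x Ux|x [p /= pU]]; last exact: pU.
have /nbhs_ballP[e /= e0 eU] : nbhs x U by exact: open_nbhs_nbhs.
have e20 : 0 < e / 2 by rewrite divr_gt0.
have [r] := rat_in_itvoo e20; rewrite in_itv /= => /andP[r0 re].
have Q i : exists q : rat, ball (x i 0) (ratr r) (ratr q : R).
  have xr : x i 0 < x i 0 + ratr r by rewrite ltrDl.
  have [q] := rat_in_itvoo xr; rewrite in_itv /= => /andP[q1 q2].
  exists q; rewrite -ball_normE /ball_ /= distrC gtr0_norm ?subr_gt0//.
  by rewrite ltrBlDl.
have [q qP] := choice Q.
have xq : ball x (ratr r) (map_mx ratr (\col_i q i) : 'cV[R]_n).
  by split=> // i j; rewrite !mxE ord1; exact: qP.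
exists (\col_i q i, r) => /=; last exact: ball_sym.
move=> y qy; apply: eU; apply: (@le_ball _ _ _ (ratr r + ratr r)).
  by rewrite [leRHS](splitr e) lerD// ltW.
exact: ball_triangle xq qy.
Qed.

Lemma measurable_fun_cV d (T : measurableType d) n (f : T -> Borel 'cV[R]_n) :
  (forall i, measurable_fun [set: T] (fun t => (f t : 'cV[R]_n) i 0)) ->
  measurable_fun [set: T] f.
Proof.
move=> mf.
apply: (@measurability _ _ _ (Borel 'cV[R]_n) _ _ (@open 'cV[R]_n)) => //.
move=> _ [U oU <-]; rewrite setTI (open_cV_rat_balls oU) preimage_bigcup.
rewrite bigcup_mkcond.
apply: countable_bigcupT_measurable => [|p]; first exact: countableP.
case: ifPn => // _; set x := map_mx _ _; set e := ratr _.
have -> : f @^-1` ball x e =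
  if 0 < e then
    \bigcap_(i : 'I_n) ((fun t => (f t : 'cV[R]_n) i 0) @^-1` ball (x i 0) e)
  else set0.
  apply/seteqP; split=> t.
    by move=> [e0 H]; rewrite e0 => i _; exact: H.
  by case: ifPn => // e0 H; split=> // i j; rewrite ord1; exact: H.
case: ifPn => // e0.
apply: fin_bigcap_measurable => [|i _]; first exact: finite_finset.
rewrite -[X in measurable X]setTI; apply: mf => //.
by apply: open_measurable; exact: ball_open.
Qed.

Definition snoc n (p : Borel 'cV[R]_n * measurableTypeR R) : Borel 'cV[R]_n.+1 :=
  \col_(i < n.+1) if unlift ord_max i is Some j then (p.1 : 'cV[R]_n) j 0
                  else p.2.

Lemma measurable_coord n (i : 'I_n) :
  measurable_fun [set: Borel 'cV[R]_n] (fun x : 'cV[R]_n => x i 0).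
Proof.
apply: (measurability _ (RGenOpens.measurableE R)).
move=> _ [_ [a [b ->] <-]]; rewrite setTI; apply: sub_sigma_algebra.
have /continuousP := @coord_continuous R n 1 i 0.
by apply; exact: interval_open.
Qed.

Lemma measurable_snoc n : measurable_fun setT (@snoc n).
Proof.
apply: measurable_fun_cV => i; under eq_fun do rewrite mxE.
case: unliftP => [j|] _; last exact: measurable_snd.
exact: (measurableT_comp (measurable_coord j) measurable_fst).
Qed.

(* Pushing the product measure forward along snoc identifies R^n * R with
   R^(n+1). *)
Definition lebesgueS n (m : {measure set (Borel 'cV[R]_n) -> \bar R}) :=
  pushforward (m \x lebesgue_measure)%E (@snoc n).

HB.instance Definition _ n m := Measure.copy (@lebesgueS n m)
  (measure_function_pushforward__canonical__measure_function_Measure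
     (m \x lebesgue_measure)%E (@measurable_snoc n)).

Fixpoint lebesgue n : {measure set (Borel 'cV[R]_n) -> \bar R} :=
  match n with
  | 0 => \d_(0 : Borel 'cV[R]_0)
  | n.+1 => lebesgueS (lebesgue n)
  end.

Lemma measurable_box n (A : 'I_n -> set (measurableTypeR R)) :
  (forall i, measurable (A i)) ->
  measurable ([set x : 'cV[R]_n | forall i, A i (x i 0)] : set (Borel 'cV[R]_n)).
Proof.
move=> mA; rewrite [X in measurable X](_ : _ =
    \bigcap_(i : 'I_n) ((fun x : 'cV[R]_n => x i 0) @^-1` A i)).
  apply: fin_bigcap_measurable => [|i _]; first exact: finite_finset.
  rewrite -[X in measurable X]setTI.
  exact: (@measurable_coord n i measurableT _ (mA _)).
by apply/seteqP; split=> x H i; [move=> _; exact: H|exact: (H i I)].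
Qed.

Lemma lebesgue_box n (A : 'I_n -> set (measurableTypeR R)) :
  (forall i, measurable (A i)) ->
  lebesgue n [set x : 'cV[R]_n | forall i, A i (x i 0)] =
  (\prod_(i < n) lebesgue_measure (A i))%E.
Proof.
elim: n A => [|n IH] A mA /=.
  by rewrite big_ord0 diracE mem_set //= => -[].
rewrite big_ord_recr /= -IH// /lebesgueS /pushforward.
have wlE (i : 'I_n) : widen_ord (leqnSn n) i = lift ord_max i.
  by apply/val_inj; rewrite /= /bump leqNgt ltn_ord.
rewrite [X in product_measure1 _ _ X](_ : _ =
    [set x : 'cV[R]_n | forall i, A (widen_ord (leqnSn n) i) (x i 0)]
      `*` A ord_max).
  rewrite product_measure1E//.
  exact: (@measurable_box n (fun i => A (widen_ord (leqnSn n) i))).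
apply/seteqP; split=> -[v r] /=.
  move=> H; split=> [i|].
    by have := H (widen_ord (leqnSn n) i); rewrite /snoc mxE wlE liftK.
  by have := H ord_max; rewrite /snoc mxE unlift_none.
move=> [H1 H2] i; rewrite /snoc mxE; case: unliftP => [j ->|->] //=.
by rewrite -wlE; exact: H1.
Qed.

End BorelColumns.

Definition mxRintegral (R : realType) d (T : measurableType d)
    (mu : {measure set T -> \bar R}) p q (D : set T) (f : T -> 'M[R]_(p, q)) :
    'M[R]_(p, q) :=
  \matrix_(i, j) \int[mu]_(t in D) f t i j.

Section ConvexBodies.
Variables (R : realType) (n : nat).
Implicit Types (K E : set 'cV[R]_n) (x y c : 'cV[R]_n) (X : 'M[R]_n).

Definition convex_body K :=
  [/\ compact K, convex_set (K : set (convex_lmodType 'cV[R]_n))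
    & K^° !=set0].

Definition extreme_points K : set 'cV[R]_n :=
  [set x | K x /\ forall y z (t : R), K y -> K z -> 0 < t < 1 ->
             x = t *: y + (1 - t) *: z -> y = x /\ z = x].

Definition volume K : \bar R := lebesgue R n K.

Definition center_of_gravity K : 'cV[R]_n :=
  (fine (volume K))^-1 *: mxRintegral (lebesgue R n) K id.

Definition inner x y : R := (x^T *m y) 0 0.

Definition posdefmx X := X^T = X /\ forall x, x != 0 -> 0 < inner (X *m x) x.

Definition ellipsoid X c : set 'cV[R]_n :=
  [set x | inner (X *m (x - c)) (x - c) <= 1].

Definition min_volume_ellipsoid K E :=
  [/\ exists X c, posdefmx X /\ E = ellipsoid X c, K `<=` E
    & forall X c, posdefmx X -> K `<=` ellipsoid X c ->
        (volume E <= volume (ellipsoid X c))%E].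

(* The pair (g.1, g.2) = (a, A) stands for the affine map x |-> a + A x. *)
Definition aff (g : 'cV[R]_n * 'M[R]_n) x : 'cV[R]_n := g.1 + g.2 *m x.

Definition aff_mul (g h : 'cV[R]_n * 'M[R]_n) : 'cV[R]_n * 'M[R]_n :=
  (g.1 + g.2 *m h.1, g.2 *m h.2).

Lemma aff_mulE g h : aff (aff_mul g h) = aff g \o aff h.
Proof. by apply/funext => x; rewrite /aff/= mulmxDr addrA mulmxA. Qed.

Definition aut_set K : set ('cV[R]_n * 'M[R]_n) :=
  [set g | g.2 \in unitmx /\ aff g @` K = K].

Lemma aut_set1 K : aut_set K (0, 1%:M).
Proof.
split; first exact: unitmx1.
rewrite [X in X @` _](_ : _ = id) ?image_id//.
by apply/funext => x; rewrite /aff/= add0r mul1mx.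
Qed.

Lemma aut_setM K g h : aut_set K g -> aut_set K h -> aut_set K (aff_mul g h).
Proof.
move=> [ug gK] [uh hK]; split; first by rewrite unitmx_mul ug.
by rewrite aff_mulE -image_comp hK gK.
Qed.

(* Aut(K), with the topology induced by 'cV[R]_n * 'M[R]_n *)
Definition Aut K : Type := set_type (aut_set K).

HB.instance Definition _ K := Topological.copy (Aut K) (set_type (aut_set K)).
HB.instance Definition _ K :=
  isPointed.Build (Aut K) (SigSub (mem_set (aut_set1 K))).

Definition aut_mul K (g h : Aut K) : Aut K :=
  SigSub (mem_set (aut_setM (set_valP g) (set_valP h))).

Definition linear_part K (g : Aut K) : 'M[R]_n := (val g).2.

Definition davies_symmetric K :=
  forall x y, extreme_points K x -> extreme_points K y ->
    exists g : Aut K, aff (val g) x = y.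

(* Left invariance suffices: Aut(K) is compact, hence unimodular, and every
   Borel probability measure on it is regular. *)
Definition haar_probability K (mu : probability (Borel (Aut K)) R) :=
  forall (g : Aut K) (B : set (Borel (Aut K))),
    measurable B -> mu (aut_mul g @` B) = mu B.

End ConvexBodies.

(* Main.v *)
Require Import Defs.
From HB Require Import structures.
From mathcomp Require Import all_boot all_order all_algebra fingroup perm.
From mathcomp Require Import all_classical all_reals all_analysis.
From mathcomp Require Import measurable_realfun ring lra.

(* If E(Y, d) contains K then det Y <= det X, because vol E(Y, d) is
   proportional to (det Y)^(-1/2).  As log det is strictly concave, the maximal
   pair (X, c) is unique, so every g = a + A in G = Aut(K) satisfies
   A^T X A = X and a + A c = c.  The functional y |-> <X(b - c), y> attached to a
   second fixed point b of G is constant on ext(K), hence on K, which has interior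
   points; so b = c, and the center of gravity is a fixed point.

   John's decomposition is not needed for the formula.  If a symmetric D has
   <D(y - c), y - c> = 0 on ext(K), then E(X + tD, c) contains K for small t of
   either sign, hence tr(X^-1 D) = 0.  Every entry m of
   M(y) = int_G A_g^-1 (y - c)(y - c)^T A_g^-T dmu is a quadratic form N in y - c
   which left invariance makes constant on ext(K), where <X(y - c), y - c> = 1.
   With D = N - m X this gives n m = tr(X^-1 N), which is the corresponding
   entry of int_G A_g^-1 X^-1 A_g^-T dmu = X^-1. *)

Set Implicit Arguments.
Unset Strict Implicit.
Unset Printing Implicit Defensive.

Import Order.TTheory GRing.Theory Num.Theory.
Import numFieldNormedType.Exports.

Local Open Scope classical_set_scope.
Local Open Scope ring_scope.

(** * Linear changes of variables for the Lebesgue measure *)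

Section LebesgueAffine.
Variable R : realType.

(** By uniqueness of Lebesgue measure, it is enough that |d| times the pushforward gives each
    interval ]x, y] its length. For d < 0 the preimage is half-open on the other side. *)
Lemma lebesgue_measure_affine (b d : R) (S : set (measurableTypeR R)) :
  d != 0 -> measurable S ->
  lebesgue_measure ((fun r : measurableTypeR R => b + d * r) @^-1` S)
    = ((`|d|^-1)%:E * lebesgue_measure S)%E.
Proof.
move=> d0 mS.
set f := fun r : measurableTypeR R => b + d * r : measurableTypeR R.
have mf : measurable_fun setT f.
  apply: measurable_funD => //; exact: measurable_funM.
have nd0 : `|d| != 0 by rewrite normr_eq0.
pose m := mscale (NngNum (normr_ge0 d))
  (measure_function_pushforward__canonical__measure_function_Measure
     lebesgue_measure mf).
suff -> : lebesgue_measure S = m S.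
  by rewrite /m /mscale /= muleA -EFinM mulVf// mul1e.
apply: lebesgue_measure_unique => // _ [[x y] _ <-] /=.
rewrite /m /mscale /= /pushforward.
have [xy|yx] := ltP x y; last first.
  rewrite set_itv_ge ?bnd_simp -?leNgt// preimage_set0 !measure0.
  by rewrite mule0.
have [dp|dn|/esym/eqP] := ltgtP 0 d; last by rewrite (negbTE d0).
  have -> : f @^-1` `]x, y]%classic = `](x - b) / d, (y - b) / d]%classic.
    apply/seteqP; split=> r /=; rewrite /f !in_itv /= ltr_pdivrMr// ler_pdivlMr//;
      by rewrite ltrBlDl lerBrDl (mulrC d).
  rewrite !lebesgue_measure_itv /= !lte_fin xy ltr_pM2r ?invr_gt0// ltrD2r xy.
  rewrite -!EFinB -EFinM gtr0_norm//; congr EFin; field.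
  by rewrite (gt_eqF dp).
have -> : f @^-1` `]x, y]%classic = `[(y - b) / d, (x - b) / d[%classic.
  apply/seteqP; split=> r /=; rewrite /f !in_itv /= ltr_ndivlMr// ler_ndivrMr//;
    by rewrite ltrBlDl lerBrDl (mulrC d) andbC.
rewrite !lebesgue_measure_itv /= !lte_fin xy ltr_nM2r ?invr_lt0// ltrD2r xy.
rewrite -!EFinB -EFinM ltr0_norm//; congr EFin; field.
by rewrite (lt_eqF dn).
Qed.

Lemma measurable_aff n (g : 'cV[R]_n * 'M[R]_n) :
  measurable_fun setT (aff g : Borel 'cV[R]_n -> Borel 'cV[R]_n).
Proof.
apply: measurable_fun_cV => i; rewrite /aff; under eq_fun do rewrite !mxE.
apply: measurable_funD => //; apply: measurable_sum => j.
by apply: measurable_funM => //; exact: measurable_coord.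
Qed.

(** Preimages turn the factor into |det A|^-1. The translation is quantified because the induction
    on the dimension replaces it by its truncation. *)
Definition scales_lebesgue n (A : 'M[R]_n) := forall a (S : set (Borel 'cV[R]_n)),
  measurable S -> lebesgue R n (aff (a, A) @^-1` S)
    = ((`|\det A|^-1)%:E * lebesgue R n S)%E.

Lemma scales_lebesgueM n (A B : 'M[R]_n) :
  scales_lebesgue A -> scales_lebesgue B -> scales_lebesgue (A *m B).
Proof.
move=> sA sB a S mS.
have -> : aff (a, A *m B) = aff (a, A) \o aff (0, B).
  by rewrite -aff_mulE /aff_mul /= mulmx0 addr0.
rewrite comp_preimage sB; last first.
  by rewrite -[X in measurable X]setTI; exact: measurable_aff.
by rewrite sA// muleA -EFinM det_mulmx normrM invfM mulrC.
Qed.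

Lemma widen_ord_lift n (i : 'I_n) : widen_ord (leqnSn n) i = lift ord_max i.
Proof. by apply/val_inj; rewrite /= /bump leqNgt ltn_ord. Qed.

(** Lower triangularity keeps [r] out of the first n coordinates of the image; for fixed [v] the
    last one is affine in [r], with slope the corner entry. This prepares the use of Tonelli. *)
Lemma aff_snoc n (a : 'cV[R]_n.+1) (A : 'M[R]_n.+1) v r : is_trig_mx A ->
  aff (a, A) (snoc (v, r)) =
  snoc (aff (\col_i a (lift ord_max i) 0,
             \matrix_(i, j) A (lift ord_max i) (lift ord_max j)) v,
        a ord_max 0 + \sum_j A ord_max (lift ord_max j) * v j 0
          + A ord_max ord_max * r).
Proof.
move=> /is_trig_mxP tA; apply/colP => i; rewrite /snoc !mxE /=.
rewrite big_ord_recr /= !mxE unlift_none.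
have vE (j : 'I_n) (k : 'I_n.+1) :
    A k (widen_ord (leqnSn n) j) * (snoc (v, r)) (widen_ord (leqnSn n) j) 0 =
    A k (lift ord_max j) * v j 0.
  by rewrite widen_ord_lift mxE liftK.
under eq_bigr do rewrite vE.
case: unliftP => [k ->|->]; last by rewrite addrA.
rewrite [A _ ord_max]tA ?mul0r ?addr0; last first.
  by rewrite -widen_ord_lift /=.
by rewrite !mxE; congr (_ + _); apply: eq_bigr => j _; rewrite mxE.
Qed.

Lemma measurable_funT_preimage d1 d2 (T1 : measurableType d1)
    (T2 : measurableType d2) (f : T1 -> T2) (S : set T2) :
  measurable_fun setT f -> measurable S -> measurable (f @^-1` S).
Proof. by move=> mf mS; rewrite -[X in measurable X]setTI; exact: mf. Qed.

(** Tonelli along [snoc]: the slice of the preimage over [v] is an affine preimage of the slice over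
    the image of [v], which contributes |d|^-1; the induction hypothesis changes variables in the
    outer integral and contributes |det A'|^-1. *)
Lemma scales_lebesgue_trig n (A : 'M[R]_n) :
  is_trig_mx A -> A \in unitmx -> scales_lebesgue A.
Proof.
elim: n A => [|n IH] A tA uA a S mS.
  rewrite det_mx00 normr1 invr1 mul1e; congr (lebesgue R 0 _).
  apply/seteqP; split=> x /=; rewrite (_ : aff _ x = x)//; by apply/colP => -[].
set A' : 'M[R]_n := \matrix_(i, j) A (lift ord_max i) (lift ord_max j).
set a' : 'cV[R]_n := \col_i a (lift ord_max i) 0.
have tA' : is_trig_mx A'.
  apply/is_trig_mxP => i j ij; rewrite mxE.
  by move/is_trig_mxP: tA; apply; rewrite -!widen_ord_lift.
have detA : \det A = \det A' * A ord_max ord_max.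
  rewrite !det_trig// big_ord_recr /=; congr (_ * _); apply: eq_bigr => i _.
  by rewrite !mxE widen_ord_lift.
have [uA' d0] : A' \in unitmx /\ A ord_max ord_max != 0.
  by move: uA; rewrite !unitmxE detA unitrM !unitfE => /andP[].
set d := A ord_max ord_max in detA d0 *.
pose B := @snoc R n @^-1` S.
have mB : measurable B by apply: measurable_funT_preimage => //; exact: measurable_snoc.
pose phi (w : Borel 'cV[R]_n) := (lebesgue_measure (xsection B w) : \bar R).
have mphi : measurable_fun setT phi by exact: measurable_fun_xsection.
have phi0 w : (0 <= phi w)%E by exact: measure_ge0.
rewrite -[X in (_ * X)%E]/(\int[lebesgue R n]_w phi w)%E.
rewrite -[LHS]/(\int[lebesgue R n]_w lebesgue_measure
  (xsection (@snoc R n @^-1` (aff (a, A) @^-1` S)) w))%E.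
transitivity (\int[lebesgue R n]_w ((`|d|^-1)%:E * (phi \o aff (a', A')) w))%E.
  apply: eq_integral => v _ /=.
  rewrite -[RHS](lebesgue_measure_affine
     (a ord_max 0 + \sum_j A ord_max (lift ord_max j) * v j 0) d0); last first.
    exact: measurable_xsection.
  congr (lebesgue_measure _); apply/seteqP; split => r;
    rewrite /xsection /B /= !inE /=; by rewrite (aff_snoc _ _ _ tA).
rewrite ge0_integralZl//; last first.
  exact: (measurableT_comp mphi (measurable_aff _)).
rewrite -[X in (_ * X)%E](@ge0_integral_pushforward _ _ _ _ R _
   (measurable_aff (a', A')) (lebesgue R n) setT phi)//.
have i0 : 0 <= `|\det A'|^-1 by rewrite invr_ge0.
rewrite (@eq_measure_integral _ _ _ setT (mscale (NngNum i0) (lebesgue R n))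
    (measure_function_pushforward__canonical__measure_function_Measure
      (lebesgue R n) (measurable_aff (a', A')))); last first.
  by move=> D mD _; exact: (IH _ tA' uA' a' _ mD).
rewrite ge0_integral_mscale// muleA -EFinM /= detA normrM invfM.
by rewrite [(_ * `|d|^-1)%R]mulrC.
Qed.

Definition box n (A : 'I_n -> set (measurableTypeR R)) : set (Borel 'cV[R]_n) :=
  [set x : 'cV[R]_n | forall i, A i (x i 0)].

Definition boxes n : set (set (Borel 'cV[R]_n)) :=
  [set S | exists2 A, (forall i, measurable (A i)) & S = box A].
Arguments boxes : clear implicits.

Lemma ball_boxes n (x : 'cV[R]_n) (e : R) : <<s boxes n >> (ball x e).
Proof.
(* In dimension 0 every box is the whole space, so an empty ball is not a box and is treated
   apart. *)
have [e0|e0] := ltP 0 e; last first.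
  rewrite (_ : ball x e = set0); first exact: (@measurable0 _ (g_sigma_algebraType (boxes n))).
  by apply/seteqP; split=> // y [e1 _]; move: (lt_le_trans e1 e0); rewrite ltxx.
apply: sub_sigma_algebra; exists (fun i => ball (x i 0) e).
  by move=> i; apply: open_measurable; exact: ball_open.
apply/seteqP; split=> y.
  by move=> [_ H] i; exact: H.
by move=> H; split=> // i j; rewrite ord1; exact: H.
Qed.

(** Sup-norm balls are boxes, and an open set is a countable union of balls with rational data. *)
Lemma measurable_boxesE n :
  measurable = <<s boxes n >> :> set (set (Borel 'cV[R]_n)).
Proof.
apply/seteqP; split.
  apply: smallest_sub; first exact: smallest_sigma_algebra.
  move=> U /= oU; rewrite (open_cV_rat_balls oU) bigcup_mkcond.
  apply: (@countable_bigcupT_measurable _ (g_sigma_algebraType (boxes n))) => [|p].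
    exact: countableP.
  case: ifPn => _; first exact: ball_boxes.
  exact: (@measurable0 _ (g_sigma_algebraType (boxes n))).
apply: smallest_sub; first exact: sigma_algebra_measurable.
by move=> _ [A mA ->]; exact: measurable_box.
Qed.

Lemma lebesgue_box_itv n (a b : 'I_n -> R) : (forall i, a i < b i) ->
  lebesgue R n (box (fun i => `]a i, b i[%classic)) = (\prod_i (b i - a i))%:E.
Proof.
move=> ab; rewrite lebesgue_box// -prodEFin; apply: eq_bigr => i _.
by rewrite lebesgue_measure_itv /= lte_fin ab EFinB.
Qed.

(** Boxes are stable under intersection and generate the Borel sets, and the open cubes of half-side
    k exhaust the space, so the uniqueness theorem for measures applies. *)
Lemma eq_measure_boxes n (m1 m2 : {measure set (Borel 'cV[R]_n) -> \bar R}) :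
  (forall A, (forall i, measurable (A i)) -> m1 (box A) = m2 (box A)) ->
  (forall a b : 'I_n -> R, (m1 (box (fun i => `]a i, b i[%classic)) < +oo)%E) ->
  forall S, measurable S -> m1 S = m2 S.
Proof.
move=> m12 mfin.
pose g (k : nat) := box (fun _ : 'I_n => `](- k%:R), k%:R[%classic).
apply: (@measure_unique _ _ _ (boxes n) g (measurable_boxesE n)).
- move=> _ _ [A mA ->] [B mB ->]; exists (fun i => A i `&` B i).
    by move=> i; exact: measurableI.
  by apply/seteqP; split=> x /=; [move=> [? ?] i|move=> H; split=> i; case: (H i)].
- by move=> k; exists (fun=> `](- k%:R), k%:R[%classic).
- apply/seteqP; split=> // x _; pose s := \sum_i `|(x : 'cV[R]_n) i 0|.
  exists (Num.truncn s).+1 => // i; rewrite /= in_itv /= -ltr_norml.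
  apply: le_lt_trans (_ : s < _).
    by rewrite /s (bigD1 i)//= lerDl sumr_ge0.
  by rewrite real_truncnS_gt// num_real.
- by move=> _ [A mA ->]; exact: m12.
- by move=> k; exact: mfin.
Qed.

(** The preimage of a box is a box whose sides are translates of the old ones in another order, so
    the product of their measures is unchanged. *)
Lemma scales_lebesgue_perm n (s : 'S_n) : scales_lebesgue (perm_mx s).
Proof.
move=> a S mS; rewrite det_perm normrX normrN1 expr1n invr1 mul1e.
set f := aff _.
have mf : measurable_fun setT (f : Borel 'cV[R]_n -> Borel 'cV[R]_n).
  exact: measurable_aff.
have fE (x : 'cV[R]_n) i : f x i 0 = a i 0 + x (s i) 0.
  by rewrite /f /aff -row_permE !mxE.
have fbox A : (forall i, measurable (A i)) ->
    lebesgue R n (f @^-1` box A) = lebesgue R n (box A).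
  move=> mA; pose B j := (fun r : measurableTypeR R =>
     a (s^-1%g j) 0 + 1 * r) @^-1` A (s^-1%g j).
  have mB j : measurable (B j).
    apply: measurable_funT_preimage (mA _).
    by apply: measurable_funD => //; exact: measurable_funM.
  transitivity (lebesgue R n (box B)).
    congr (lebesgue R n _); apply/seteqP; split=> x.
      move=> H i; have := H (s^-1%g i).
      by rewrite fE permKV /B /= mul1r.
    by move=> H i; rewrite fE; have := H (s i); rewrite /B /= permK mul1r.
  rewrite [LHS]lebesgue_box// [RHS]lebesgue_box// [RHS](reindex_inj (@perm_inj _ s^-1%g)) /=.
  apply: eq_bigr => j _; rewrite /B lebesgue_measure_affine ?oner_eq0//.
  by rewrite normr1 invr1 mul1e.
apply: (@eq_measure_boxes n
  (measure_function_pushforward__canonical__measure_function_Measure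
     (lebesgue R n) mf) (lebesgue R n)) => //= a' b'.
rewrite [ltLHS]fbox//.
have [H|/existsNP [i /negP]] := pselect (forall i, a' i < b' i).
  by rewrite lebesgue_box_itv// ltry.
rewrite -leNgt => ba; rewrite (_ : box _ = set0) ?measure0//.
apply/seteqP; split=> // x /(_ i); rewrite /= in_itv /= => /andP[ax xb].
by move: (lt_le_trans (lt_trans ax xb) ba); rewrite ltxx.
Qed.

(** The LUP factorization reduces to permutation and triangular matrices, since the scaling property
    is multiplicative. *)
Lemma scales_lebesgue_unitmx n (A : 'M[R]_n) : A \in unitmx -> scales_lebesgue A.
Proof.
case: n A => [|n] A uA.
  by apply: scales_lebesgue_trig => //; apply/is_trig_mxP => -[].
have := cormen_lup_correct A; have := cormen_lup_perm A.
have := cormen_lup_lower A; have := cormen_lup_upper A.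
have := cormen_lup_detL A.
case: (cormen_lup A) => -[P L] U /= detL Uu Ll /is_perm_mxP[s ->] PA.
have -> : A = perm_mx s^-1%g *m (L *m U).
  by rewrite -[L *m U]PA -[_ * A]/(_ *m A) mulmxA -perm_mxM mulVg perm_mx1 mul1mx.
have uL : L \in unitmx by rewrite unitmxE detL unitr1.
have uU : U \in unitmx.
  have : L *m U \in unitmx.
    by rewrite -[L *m U]PA -[_ * A]/(_ *m A) unitmx_mul unitmx_perm uA.
  by rewrite unitmx_mul => /andP[].
apply: scales_lebesgueM; first exact: scales_lebesgue_perm.
apply: scales_lebesgueM.
  apply: scales_lebesgue_trig => //; apply/is_trig_mxP => i j ij.
  by rewrite Ll 1?ltnW// (negbTE (_ : i != j))// neq_ltn ij.
(* Reversing the order of rows and columns makes the upper triangular [U] lower triangular. *)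
pose w := perm (@rev_ord_inj n.+1).
have -> : U = perm_mx w^-1%g *m ((perm_mx w *m (U *m perm_mx w^-1%g)) *m perm_mx w).
  rewrite !mulmxA -perm_mxM mulVg perm_mx1 mul1mx -mulmxA -perm_mxM mulVg.
  by rewrite perm_mx1 mulmx1.
apply: scales_lebesgueM; first exact: scales_lebesgue_perm.
apply: scales_lebesgueM; last exact: scales_lebesgue_perm.
apply: scales_lebesgue_trig; last by rewrite !unitmx_mul !unitmx_perm uU.
apply/is_trig_mxP => i j ij; rewrite -row_permE -col_permE !mxE !permE Uu//=.
by rewrite !subSS ltn_sub2l// (leq_trans ij)// -ltnS.
Qed.

End LebesgueAffine.

(** * Positive definite matrices *)

Section PositiveDefinite.
Variable R : realType.

Lemma innerE n (x y : 'cV[R]_n) : inner x y = \sum_i x i 0 * y i 0.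
Proof. by rewrite /inner mxE; apply: eq_bigr => i _; rewrite mxE. Qed.

Lemma innerC n (x y : 'cV[R]_n) : inner x y = inner y x.
Proof. by rewrite !innerE; apply: eq_bigr => i _; rewrite mulrC. Qed.

Lemma innerDl n (x y z : 'cV[R]_n) : inner (x + y) z = inner x z + inner y z.
Proof. by rewrite /inner linearD /= mulmxDl mxE. Qed.

Lemma innerDr n (x y z : 'cV[R]_n) : inner z (x + y) = inner z x + inner z y.
Proof. by rewrite ![inner z _]innerC innerDl. Qed.

Lemma innerZl n a (x y : 'cV[R]_n) : inner (a *: x) y = a * inner x y.
Proof. by rewrite /inner linearZ /= -scalemxAl mxE. Qed.

Lemma innerZr n a (x y : 'cV[R]_n) : inner x (a *: y) = a * inner x y.
Proof. by rewrite innerC innerZl innerC. Qed.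

Lemma innerNl n (x y : 'cV[R]_n) : inner (- x) y = - inner x y.
Proof. by rewrite -scaleN1r innerZl mulN1r. Qed.

Lemma innerNr n (x y : 'cV[R]_n) : inner x (- y) = - inner x y.
Proof. by rewrite innerC innerNl innerC. Qed.

Lemma inner_mulmxl m n (A : 'M[R]_(m, n)) x y :
  inner (A *m x) y = inner x (A^T *m y).
Proof. by rewrite /inner trmx_mul mulmxA. Qed.

Lemma inner_ge0 n (x : 'cV[R]_n) : 0 <= inner x x.
Proof. by rewrite innerE sumr_ge0// => i _; rewrite -expr2 sqr_ge0. Qed.

Lemma inner_eq0 n (x : 'cV[R]_n) : (inner x x == 0) = (x == 0).
Proof.
apply/eqP/eqP => [|->]; last by rewrite innerE big1// => i _; rewrite mxE mul0r.
rewrite innerE => /eqP; rewrite psumr_eq0; last first.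
  by move=> i _; rewrite -expr2 sqr_ge0.
move=> /allP H; apply/colP => i; rewrite mxE; apply/eqP.
by have := H i; rewrite mem_index_enum mulf_eq0 orbb => /(_ isT).
Qed.

Lemma inner_col_mx m n (a b : 'cV[R]_m) (x y : 'cV[R]_n) :
  inner (col_mx a x) (col_mx b y) = inner a b + inner x y.
Proof. by rewrite /inner tr_col_mx mul_row_col mxE. Qed.

Lemma posdefmx_ge0 n (X : 'M[R]_n) v : posdefmx X -> 0 <= inner (X *m v) v.
Proof.
move=> [_ pX]; have [->|/pX/ltW//] := eqVneq v 0.
by rewrite mulmx0 (eqP (_ : inner 0 0 == 0)) ?inner_eq0.
Qed.

Lemma posdefmx_congr n (X P : 'M[R]_n) :
  posdefmx X -> P \in unitmx -> posdefmx (P^T *m X *m P).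
Proof.
move=> [sX pX] uP; split; first by rewrite !trmx_mul trmxK sX mulmxA.
move=> v v0; rewrite -2!mulmxA inner_mulmxl trmxK; apply: pX.
by apply: contra v0 => /eqP Pv0; rewrite -(mulKmx uP v) Pv0 mulmx0.
Qed.

Lemma posdefmx1 n : posdefmx (1%:M : 'M[R]_n).
Proof.
split; first by rewrite trmx1.
by move=> x x0; rewrite mul1mx lt_neqAle inner_ge0 eq_sym inner_eq0 x0.
Qed.

Lemma posdefmxZ n a (X : 'M[R]_n) : 0 < a -> posdefmx X -> posdefmx (a *: X).
Proof.
move=> a0 [sX pX]; split; first by rewrite linearZ /= sX.
by move=> v v0; rewrite -scalemxAl innerZl mulr_gt0// pX.
Qed.

Lemma posdefmxD n (X Y : 'M[R]_n) :
  posdefmx X -> posdefmx Y -> posdefmx (X + Y).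
Proof.
move=> [sX pX] [sY pY]; split; first by rewrite linearD /= sX sY.
by move=> v v0; rewrite mulmxDl innerDl addr_gt0// ?pX ?pY.
Qed.

(** [S] is the Schur complement of the pivot [d]. This is the induction step for both the Cholesky
    factorization and the determinant bound. *)
Lemma posdefmx_schur n (X : 'M[R]_(1 + n)) : posdefmx X ->
  exists d u (S : 'M[R]_n), [/\ 0 < d, posdefmx S &
    X = block_mx d%:M u^T u (S + d^-1 *: (u *m u^T))].
Proof.
move=> [sX pX]; set d := X 0 0; set u := dlsubmx X.
pose S := drsubmx X - d^-1 *: (u *m u^T).
have XE : X = block_mx d%:M u^T u (S + d^-1 *: (u *m u^T)).
  rewrite /S subrK -[LHS]submxK /u trmx_dlsub sX; congr (block_mx _ _ _ _).
  by apply/matrixP => i j; rewrite !ord1 !mxE /= mulr1n /d; congr (X _ _); apply/val_inj.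
have d0 : 0 < d.
  have := pX (delta_mx 0 0); rewrite -colE.
  have -> : inner (col 0 X) (delta_mx 0 0) = d.
    rewrite innerE (bigD1 0)//= big1 ?addr0 => [|i /negbTE i0].
      by rewrite !mxE !eqxx mulr1.
    by rewrite !mxE i0 mulr0.
  apply; apply/eqP => /colP/(_ 0); rewrite !mxE !eqxx /= => /eqP.
  by rewrite oner_eq0.
exists d, u, S; split=> //; split.
  rewrite /S linearB /= linearZ /= trmx_mul trmxK.
  by rewrite trmx_drsub sX.
(* For given [v], this first entry minimizes the quadratic form of [X], and the minimum is the form
   of [S] at [v]. *)
move=> v v0; have := pX (col_mx (- d^-1 *: (u^T *m v)) v).
rewrite XE mul_block_col inner_col_mx mul_scalar_mx scalerA mulrN divff ?gt_eqF//.
rewrite scaleN1r addNr.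
have -> : forall w : 'cV[R]_1, inner 0 w = 0.
  by move=> w; rewrite /inner trmx0 mul0mx mxE.
rewrite add0r mulmxDl -scalemxAr -scalemxAl mulmxA addrCA.
rewrite [- d^-1 *: (u *m _ *m v)]scaleNr addNr addr0.
apply.
by rewrite -[X in _ != X]col_mx0; apply: contra v0 => /eqP/eq_col_mx[_ ->].
Qed.

(** Recursion on the Schur complement, with the square root of the pivot as the new diagonal
    entry. *)
Lemma posdefmx_cholesky n (X : 'M[R]_n) : posdefmx X ->
  exists2 P, P \in unitmx & X = P^T *m P.
Proof.
elim: n X => [|n IH] X pX.
  by exists 1%:M; [exact: unitmx1|apply/matrixP => -[]].
have [d [u [S [d0 /IH[P uP SE] XE]]]] := @posdefmx_schur n X pX.
have s0 : Num.sqrt d != 0 by rewrite gt_eqF// sqrtr_gt0.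
have ss : Num.sqrt d * Num.sqrt d = d by rewrite -expr2 sqr_sqrtr// ltW.
exists (block_mx (Num.sqrt d)%:M ((Num.sqrt d)^-1 *: u^T) 0 P).
  rewrite unitmxE (@det_ublock _ 1 n) det_scalar1 unitrM unitfE s0.
  by rewrite -unitmxE.
rewrite XE (@tr_block_mx _ 1 n 1 n) (@mulmx_block _ 1 n 1 n 1 n) trmx0 !mul0mx.
have -> : ((Num.sqrt d)^-1 *: u^T)^T = (Num.sqrt d)^-1 *: u.
  by rewrite linearZ /= trmxK.
rewrite tr_scalar_mx !mulmx0 !addr0 -scalar_mxM ss.
rewrite mul_scalar_mx mul_mx_scalar !scalerA divff// !scale1r.
by rewrite -scalemxAr -scalemxAl scalerA -invfM ss SE addrC.
Qed.

Lemma posdefmx_unit n (X : 'M[R]_n) : posdefmx X -> X \in unitmx.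
Proof.
by move=> /posdefmx_cholesky[P uP ->]; rewrite unitmx_mul unitmx_tr uP.
Qed.

Lemma posdefmx_det n (X : 'M[R]_n) : posdefmx X -> 0 < \det X.
Proof.
move=> /posdefmx_cholesky[P uP ->]; rewrite det_mulmx det_tr -expr2.
by rewrite lt_neqAle sqr_ge0 eq_sym sqrf_eq0 -unitfE -unitmxE uP.
Qed.

(** In terms of eigenvalues this is log a <= a - 1, summed. The proof splits off one pivot at a time
    instead: det M = d det S, tr M = d + tr S + |u|^2 / d, and d <= exp (d - 1). Equality forces d =
    1, then u = 0, then S = 1. *)
Lemma posdefmx_det_le_exp n (M : 'M[R]_n) : posdefmx M ->
  \det M <= expR (\tr M - n%:R) ?= iff (M == 1%:M).
Proof.
elim: n M => [|n IH] M pM.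
  have -> : M = 1%:M by apply/matrixP => -[].
  rewrite det1 mxtrace1 subrr expR0 eqxx; exact/leif_refl.
have [d [u [S [d0 pS ME]]]] := @posdefmx_schur n M pM.
have := IH _ pS; set e := expR _ => -[le1 eq1].
have detM : \det M = d * \det S.
  have -> : M = block_mx d%:M 0 u S *m block_mx 1%:M (d^-1 *: u^T) 0 1%:M.
    rewrite (@mulmx_block _ 1 n 1 n 1 n) !mulmx0 !mulmx1 !addr0.
    by rewrite mul_scalar_mx scalerA divff ?gt_eqF// scale1r -scalemxAr addrC ME.
  by rewrite det_mulmx (@det_lblock _ 1 n) (@det_ublock _ 1 n) det_scalar1 !det1 !mulr1.
have trM : expR (\tr M - n.+1%:R) = expR (d - 1) * (e * expR (d^-1 * inner u u)).
  rewrite ME (@mxtrace_block _ 1 n) mxtrace_scalar linearD /= linearZ /=.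
  rewrite [\tr (u *m _)]mxtrace_mulC -!expRD; congr expR.
  have -> : \tr (u^T *m u) = inner u u by rewrite /mxtrace big_ord1.
  by rewrite mulr1n -natr1; ring.
have dS := posdefmx_det pS.
have dle : d <= expR (d - 1) by have := expR_ge1Dx (d - 1); rewrite addrC subrK.
have ule : 1 <= expR (d^-1 * inner u u).
  by rewrite -expR0 ler_expR mulr_ge0 ?inner_ge0// invr_ge0 ltW.
rewrite detM trM; split.
  rewrite ler_pM// ?(ltW d0) ?(ltW dS)//; apply: (le_trans le1).
  by rewrite ler_peMr// ltW// expR_gt0.
apply/eqP/eqP => [H|H].
  have d1 : d = 1.
    apply/eqP; apply: contraT => dn1.
    have : d * \det S < expR (d - 1) * (e * expR (d^-1 * inner u u)).
      apply: (@lt_le_trans _ _ (expR (d - 1) * \det S)).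
        rewrite ltr_pM2r//; have := @expR_gt1Dx _ (d - 1).
        by rewrite subr_eq0 [1 + _]addrC subrK; apply.
      rewrite ler_pM2l ?expR_gt0//; apply: (le_trans le1).
      by rewrite ler_peMr// ltW// expR_gt0.
    by rewrite H ltxx.
  move: H; rewrite d1 subrr expR0 invr1 !mul1r => H.
  have u0 : u = 0.
    apply/eqP; rewrite -inner_eq0; apply: contraT => un0.
    have : \det S < e * expR (inner u u).
      apply: (le_lt_trans le1); rewrite ltr_pMr ?expR_gt0//.
      by rewrite -expR0 ltr_expR lt_neqAle eq_sym un0 inner_ge0.
    by rewrite H ltxx.
  move: H; rewrite u0 (eqP (_ : inner 0 0 == 0)) ?inner_eq0// expR0 mulr1.
  move/eqP; rewrite eq1 => /eqP S1.
  rewrite ME d1 u0 S1 mul0mx scaler0 addr0 trmx0.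
  by rewrite -(@scalar_mx_block _ 1 n).
have : M = @block_mx R 1 n 1 n 1%:M 0 0 1%:M by rewrite H (@scalar_mx_block _ 1 n).
rewrite ME => /(@eq_block_mx _ 1 n 1 n)[d1 _ u0].
have -> : d = 1 by move/matrixP: d1 => /(_ 0 0); rewrite !mxE !mulr1n.
rewrite u0 mul0mx scaler0 addr0 => S1.
rewrite subrr expR0 invr1 !mul1r (eqP (_ : inner 0 0 == 0)) ?inner_eq0//.
by rewrite expR0 mulr1; apply/eqP; rewrite eq1 S1.
Qed.

(* Concavity of log det: the tangent at Z lies above the graph. *)
Lemma posdefmx_det_tangent n (X Z : 'M[R]_n) : posdefmx X -> posdefmx Z ->
  \det X <= \det Z * expR (\tr (invmx Z *m X) - n%:R) ?= iff (X == Z).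
Proof.
move=> pX /[dup] pZ /posdefmx_cholesky[P uP ZE].
have uPt : P^T \in unitmx by rewrite unitmx_tr.
(* Congruence by P^-1 sends Z to the identity and X to [M], which reduces the claim to the previous
   bound. *)
pose Q := invmx P; have uQ : Q \in unitmx by rewrite unitmx_inv.
have := posdefmx_det_le_exp (posdefmx_congr pX uQ).
set M := _ *m Q => -[le1 eq1].
have -> : \tr (invmx Z *m X) = \tr M.
  have uZ : P^T *m P \in unitmx by rewrite unitmx_mul uPt.
  have iZ : invmx (P^T *m P) = Q *m Q^T.
    apply: (can_inj (mulKmx uZ)).
    by rewrite mulmxV// !mulmxA mulmxK// -trmx_mul mulVmx// trmx1.
  by rewrite ZE /M [RHS]mxtrace_mulC iZ mulmxA.
have detX : \det X = \det Z * \det M.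
  rewrite ZE /M !det_mulmx !det_tr.
  have : \det P * \det Q = 1 by rewrite -det_mulmx mulmxV// det1.
  move=> PQ; transitivity ((\det P * \det Q) ^+ 2 * \det X); last by ring.
  by rewrite PQ expr1n mul1r.
have XZ : (X == Z) = (M == 1%:M).
  apply/eqP/eqP => [E|M1].
    by rewrite /M E ZE !mulmxA -trmx_mul mulmxV// trmx1 mul1mx mulmxV.
  have : P^T *m M *m P = P^T *m P by rewrite M1 mulmx1.
  by rewrite -ZE /M !mulmxA -trmx_mul mulVmx// trmx1 mul1mx mulmxKV.
have dZ := posdefmx_det pZ.
rewrite detX XZ; split; first by rewrite ler_pM2l.
by rewrite -eq1 (inj_eq (mulfI (lt0r_neq0 dZ))).
Qed.

Lemma inner_mulmx_bound n (D : 'M[R]_n) v :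
  `|inner (D *m v) v| <= (\sum_i \sum_j `|D i j|) * inner v v.
Proof.
have vle i : v i 0 ^+ 2 <= inner v v.
  rewrite innerE (bigD1 i)//= expr2 lerDl sumr_ge0// => j _.
  by rewrite -expr2 sqr_ge0.
have vv i j : `|v i 0 * v j 0| <= inner v v.
  rewrite ler_norml; have := vle i; have := vle j.
  have := sqr_ge0 (v i 0 + v j 0); have := sqr_ge0 (v i 0 - v j 0).
  rewrite sqrrB sqrrD => *; apply/andP; split; lra.
rewrite innerE mulr_suml; apply: le_trans (ler_norm_sum _ _ _) _.
apply: ler_sum => i _; rewrite mxE mulr_suml [X in _ <= X]mulr_suml.
apply: le_trans (ler_norm_sum _ _ _) _; apply: ler_sum => j _.
by rewrite -mulrA normrM ler_wpM2l// mulrC.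
Qed.

(** With X = P^T P, <v, v> is the form of D = P^-T P^-1 at P v, hence at most the entry sum of |D|
    times <P v, P v> = <X v, v>. *)
Lemma posdefmx_coercive n (X : 'M[R]_n) : posdefmx X ->
  exists2 C, 0 < C & forall v, inner v v <= C * inner (X *m v) v.
Proof.
move=> /posdefmx_cholesky[P uP ->].
pose D := (invmx P)^T *m invmx P.
exists (1 + \sum_i \sum_j `|D i j|).
  by rewrite ltr_pwDl// sumr_ge0// => i _; rewrite sumr_ge0.
move=> v; have := inner_mulmx_bound D (P *m v).
rewrite /D -!mulmxA mulKmx// inner_mulmxl trmxK mulKmx//.
rewrite [inner (_ *m _) v]inner_mulmxl trmxK ger0_norm ?inner_ge0//.
by move=> /le_trans; apply; rewrite ler_wpM2r ?inner_ge0// lerDr.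
Qed.

Lemma posdefmx_perturb n (X D : 'M[R]_n) : posdefmx X -> D^T = D ->
  exists2 e, 0 < e & forall t, `|t| < e -> posdefmx (X + t *: D).
Proof.
move=> /[dup] pX [sX _] sD; have [C C0 HC] := posdefmx_coercive pX.
pose B := \sum_i \sum_j `|D i j|.
have B0 : 0 <= B by rewrite sumr_ge0// => i _; rewrite sumr_ge0.
have CB0 : 0 < (B + 1) * C by rewrite mulr_gt0// ltr_wpDl.
(* For smaller |t|, |t <D v, v>| <= |t| B <v, v> < <v, v> / C <= <X v, v>. The added 1 keeps the
   denominator positive when D = 0. *)
exists ((B + 1) * C)^-1; first by rewrite invr_gt0.
move=> t te; split; first by rewrite linearD linearZ /= sX sD.
move=> v v0; rewrite mulmxDl innerDl -scalemxAl innerZl.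
have qX0 : 0 < inner v v by rewrite lt_neqAle eq_sym inner_eq0 v0 inner_ge0.
have qX : inner v v / C <= inner (X *m v) v by rewrite ler_pdivrMr// mulrC.
have qD : `|t * inner (D *m v) v| <= `|t| * (B * inner v v).
  by rewrite normrM ler_wpM2l// inner_mulmx_bound.
have : `|t| * ((B + 1) * inner v v) < inner v v / C.
  rewrite mulrA ltr_pdivlMr// mulrAC -[ltRHS]mul1r ltr_pM2r//.
  by rewrite -mulrA -ltr_pdivlMr// div1r.
have : `|t| * (B * inner v v) <= `|t| * ((B + 1) * inner v v).
  by rewrite ler_wpM2l// ler_wpM2r ?inner_ge0// lerDl.
by move: qD; rewrite ler_norml => /andP[]; lra.
Qed.

End PositiveDefinite.

(** * Extreme points and volumes *)

Section Quadratics.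
Variables (R : realType) (n : nat).
Implicit Types (K : set 'cV[R]_n) (x y c v : 'cV[R]_n) (X Y : 'M[R]_n).

Lemma continuous_quadratic Y c v :
  continuous (fun x => inner (Y *m (x - c)) (x - c) + inner v x).
Proof.
have coord i : continuous (fun x : 'cV[R]_n => x i 0) by exact: coord_continuous.
have cx i : continuous (fun x => (x - c) i 0).
  rewrite (_ : (fun x => _) = (fun x => x i 0 - c i 0)); last first.
    by apply/funext => x; rewrite !mxE.
  by move=> x; apply: continuousB; [exact: coord|exact: cst_continuous].
have csum (F : 'I_n -> 'cV[R]_n -> R) :
    (forall i, continuous (F i)) -> continuous (fun x => \sum_i F i x).
  by move=> cF; apply: continuous_big => //; exact: add_continuous.
under eq_fun do rewrite !innerE.
move=> x; apply: continuousD; apply: (csum) => i {}x.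
  apply: continuousM; last exact: cx.
  rewrite (_ : (fun x => _) = (fun x => \sum_j Y i j * (x - c) j 0)); last first.
    by apply/funext => y; rewrite mxE.
  by apply: csum => j {}x; apply: continuousM; [exact: cst_continuous|exact: cx].
by apply: continuousM; [exact: cst_continuous|exact: coord].
Qed.

(* Strict convexity makes every maximizer extreme; this replaces Krein-Milman
   throughout. *)
Lemma extreme_quadratic_max K Y c v : K !=set0 -> compact K -> posdefmx Y ->
  let f x := inner (Y *m (x - c)) (x - c) + inner v x in
  exists2 z, extreme_points K z & forall y, K y -> f y <= f z.
Proof.
move=> K0 cK pY f.
have [z Kz zmax] : exists2 z, z \in K & forall y, y \in K -> f y <= f z.
  apply: compact_EVT_max => //; apply: continuous_subspaceT.
  exact: continuous_quadratic.
rewrite inE in Kz; exists z => [|y Ky]; last by apply: zmax; rewrite inE.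
split=> // a b t Ka Kb /andP[t0 t1] zE.
suff ab : a = b.
  by rewrite zE ab -scalerDl addrCA subrr addr0 scale1r.
apply/eqP; rewrite -subr_eq0; apply: contraT => /(proj2 pY); rewrite -/f => q0.
have fa : f a <= f z by apply: zmax; rewrite inE.
have fb : f b <= f z by apply: zmax; rewrite inE.
(* The exact convexity defect of a quadratic: its last term is positive when a and b differ, so f z
   would lie strictly below the maximum. *)
have : f z = t * f a + (1 - t) * f b - t * (1 - t) * inner (Y *m (a - b)) (a - b).
  have zc : z - c = t *: (a - c) + (1 - t) *: (b - c).
    by rewrite zE; apply/colP => i; rewrite !mxE; ring.
  have ab : a - b = (a - c) - (b - c) by rewrite opprB addrA subrK.
  rewrite /f zc ab zE; move: (a - c) (b - c) => p r.
  have sY : inner (Y *m r) p = inner (Y *m p) r.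
    by rewrite inner_mulmxl (proj1 pY) innerC.
  rewrite !mulmxDr !mulmxN -!scalemxAr.
  rewrite !(innerDl, innerDr, innerNl, innerNr, innerZl, innerZr) sY.
  ring.
have : 0 < t * (1 - t) * inner (Y *m (a - b)) (a - b).
  by rewrite !mulr_gt0// subr_gt0.
have : t * f a <= t * f z by rewrite ler_wpM2l// ltW.
have : (1 - t) * f b <= (1 - t) * f z by rewrite ler_wpM2l// subr_ge0 ltW.
lra.
Qed.

(** The maximum over K is attained at an extreme point. The linear term [inner v] makes it possible
    to test linear functionals as well as ellipsoids. *)
Lemma quadratic_le_extreme K Y c v s : compact K -> posdefmx Y ->
  (forall z, extreme_points K z ->
     inner (Y *m (z - c)) (z - c) + inner v z <= s) ->
  forall y, K y -> inner (Y *m (y - c)) (y - c) + inner v y <= s.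
Proof.
move=> cK pY H y Ky.
have [|z /H zs zmax] := extreme_quadratic_max c v _ cK pY; first by exists y.
exact: le_trans (zmax _ Ky) zs.
Qed.

(** The Euclidean norm attains its maximum on K; from u^2 <= q follows u < 1 + q. *)
Lemma compact_coord_bounded K : compact K ->
  exists2 C, 0 < C & forall x i, K x -> `|x i 0| < C.
Proof.
move=> cK; have [->|/set0P K0] := eqVneq K set0; first by exists 1.
have [z _ /= zmax] := extreme_quadratic_max 0 0 K0 cK (posdefmx1 R n).
exists (1 + inner z z); first by rewrite ltr_pwDl// inner_ge0.
move=> x i /zmax; rewrite !mul1mx !subr0.
have i0 (w : 'cV[R]_n) : inner 0 w = 0 by rewrite /inner trmx0 mul0mx mxE.
rewrite !i0 !addr0 => xz.
have : `|x i 0| ^+ 2 <= inner z z.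
  apply: le_trans xz; rewrite real_normK ?num_real// innerE (bigD1 i)//=.
  by rewrite expr2 lerDl sumr_ge0// => j _; rewrite -expr2 sqr_ge0.
have := normr_ge0 (x i 0); set u := `|x i 0|; nra.
Qed.

End Quadratics.

(** * Volumes of compact sets and ellipsoids *)

Section Volumes.
Variables (R : realType) (n : nat).
Implicit Types (K : set 'cV[R]_n) (x y c v : 'cV[R]_n) (X Y : 'M[R]_n).

Lemma measurable_compact K : compact K -> measurable (K : set (Borel 'cV[R]_n)).
Proof.
move=> /compact_closed-/(_ (@norm_hausdorff _ _)) cK.
rewrite -[K]setCK; apply: measurableC; apply: sub_sigma_algebra.
exact: closed_openC.
Qed.

Lemma volume_lt_pinfty K C : 0 < C -> measurable (K : set (Borel 'cV[R]_n)) ->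
  (forall x i, K x -> `|x i 0| < C) -> (volume K < +oo)%E.
Proof.
move=> C0 mK KC.
pose B := @box R n (fun=> `](- C), C[%classic).
apply: (@le_lt_trans _ _ (volume B)).
  apply: le_measure; rewrite ?inE//; first exact: measurable_box.
  by move=> x Kx i; rewrite /= in_itv /= -ltr_norml KC.
by rewrite /volume lebesgue_box_itv ?ltry// => i; rewrite gtrN.
Qed.

Lemma volume_gt0 K x (e : R) : 0 < e -> measurable (K : set (Borel 'cV[R]_n)) ->
  ball x e `<=` K -> (0 < volume K)%E.
Proof.
move=> e0 mK xK.
pose B := @box R n (fun i => `](x i 0 - e), (x i 0 + e)[%classic).
apply: (@lt_le_trans _ _ (volume B)).
  rewrite /volume lebesgue_box_itv => [|i]; last by rewrite ltrBlDr -addrA ltrDl addr_gt0.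
  rewrite lte_fin prodr_gt0// => i _; lra.
apply: le_measure; rewrite ?inE//; first exact: measurable_box.
move=> y By; apply: xK; split=> // i j; rewrite ord1.
have := By i; rewrite /= in_itv /= /ball /= distrC ltr_distl => /andP[? ?].
by apply/andP; split.
Qed.

Lemma ellipsoid_cholesky (P : 'M[R]_n) c :
  ellipsoid (P^T *m P) c = aff (- (P *m c), P) @^-1` ellipsoid 1%:M 0.
Proof.
apply/seteqP; split=> x; rewrite /ellipsoid /aff /= subr0 mul1mx [- _ + _]addrC -mulmxBr;
  by rewrite -mulmxA inner_mulmxl trmxK.
Qed.

Lemma measurable_ellipsoid X c : measurable (ellipsoid X c : set (Borel 'cV[R]_n)).
Proof.
rewrite -[ellipsoid X c]setCK; apply: measurableC; apply: sub_sigma_algebra.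
apply: closed_openC.
have -> : ellipsoid X c =
    (fun x => inner (X *m (x - c)) (x - c) + inner 0 x) @^-1` [set r | r <= 1].
  apply/seteqP; split=> x; rewrite /ellipsoid /= [inner 0 x]innerE big1 ?addr0// => i _;
    by rewrite mxE mul0r.
apply: closed_comp; last exact: closed_le.
by move=> x _; exact: continuous_quadratic.
Qed.

(** The Euclidean unit ball lies in a cube and contains a small sup-norm ball. Its volume [b] is a
    common factor that cancels when ellipsoids are compared. *)
Lemma volume_ball : exists2 b : R, 0 < b & volume (@ellipsoid R n 1%:M 0) = b%:E.
Proof.
have mB := measurable_ellipsoid 1%:M 0.
have fin : (volume (@ellipsoid R n 1%:M 0) < +oo)%E.
  apply: (@volume_lt_pinfty _ 2) => // x i.
  rewrite /ellipsoid /= subr0 mul1mx innerE (bigD1 i)//=.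
  have : 0 <= \sum_(j < n | j != i) x j 0 * x j 0.
    by rewrite sumr_ge0// => j _; rewrite -expr2 sqr_ge0.
  by move=> ? ?; rewrite ltr_norml; apply/andP; split; nra.
have pos : (0 < volume (@ellipsoid R n 1%:M 0))%E.
  have n0 : 0 < n.+1%:R :> R by [].
  (* With radius 1 / (n + 1), the n squared coordinates sum to at most n / (n + 1); the shift by one
     also covers n = 0. *)
  apply: (@volume_gt0 _ 0 (n.+1%:R^-1)) => //.
  move=> x [_ xB]; rewrite /ellipsoid /= subr0 mul1mx innerE.
  apply: (@le_trans _ _ (\sum_(i < n) n.+1%:R^-1)).
    apply: ler_sum => i _; have := xB i 0; rewrite mxE /ball /= sub0r normrN => xi.
    rewrite -expr2 -real_normK ?num_real//.
    apply: (@le_trans _ _ (`|x i 0| * 1)).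
      rewrite expr2 ler_wpM2l// (le_trans (ltW xi))// invf_le1// ler1n//.
    by rewrite mulr1 ltW.
  rewrite sumr_const card_ord -[_ *+ n]mulr_natl ler_pdivrMr// mul1r ler_nat.
  exact: leqnSn.
exists (fine (volume (@ellipsoid R n 1%:M 0))).
  by rewrite fine_gt0// pos.
by rewrite fineK// ge0_fin_numE// ltW.
Qed.

(** For X = P^T P the ellipsoid is an affine preimage of the unit ball, of volume b / |det P|, and
    det X = (det P)^2. *)
Lemma volume_ellipsoid_le X Y c d : posdefmx X -> posdefmx Y ->
  (volume (ellipsoid X c) <= volume (ellipsoid Y d))%E = (\det Y <= \det X).
Proof.
move=> /posdefmx_cholesky[P uP ->] /posdefmx_cholesky[Q uQ ->].
have [b b0 vb] := volume_ball.
have vE (S : 'M[R]_n) e : S \in unitmx ->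
    volume (ellipsoid (S^T *m S) e) = (`|\det S|^-1 * b)%:E.
  move=> uS; rewrite ellipsoid_cholesky /volume scales_lebesgue_unitmx//.
    by rewrite -/(volume _) vb.
  exact: measurable_ellipsoid.
rewrite !vE// lee_fin ler_pM2r// !det_mulmx !det_tr -!expr2.
have pos (S : 'M[R]_n) : S \in unitmx -> 0 < `|\det S|.
  by rewrite unitmxE unitfE normr_gt0.
rewrite lef_pV2 ?posrE ?pos// -(real_normK (num_real (\det P))).
by rewrite -(real_normK (num_real (\det Q))) ler_sqr// nnegrE.
Qed.

End Volumes.

(** * Ellipsoids of maximal determinant *)

Section Maximality.
Variables (R : realType) (n : nat).
Implicit Types (K : set 'cV[R]_n) (x y c v : 'cV[R]_n) (X Y : 'M[R]_n).

Definition max_det_ellipsoid K X c := [/\ posdefmx X, K `<=` ellipsoid X c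
  & forall Y d, posdefmx Y -> K `<=` ellipsoid Y d -> \det Y <= \det X].

Lemma min_volume_max_det K X c : posdefmx X ->
  min_volume_ellipsoid K (ellipsoid X c) -> max_det_ellipsoid K X c.
Proof.
move=> pX [_ KX minX]; split=> // Y d pY KY.
by rewrite -(volume_ellipsoid_le c d pX pY); exact: minX.
Qed.

Lemma quadratic_centerE (X : 'M[R]_n) x c e : X^T = X ->
  inner (X *m (x - c)) (x - c) = inner (X *m (x - e)) (x - e)
    + 2 * inner (X *m (e - c)) (x - e) + inner (X *m (e - c)) (e - c).
Proof.
move=> sX; have -> : x - c = (x - e) + (e - c) by rewrite addrA subrK.
move: (x - e) (e - c) => p r.
have : inner (X *m p) r = inner (X *m r) p.
  by rewrite inner_mulmxl sX innerC.
by rewrite mulmxDr !innerDl !innerDr => ->; ring.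
Qed.

(** Otherwise X could be multiplied by a factor above 1, which increases the determinant in positive
    dimension. The center [e] is arbitrary. *)
Lemma max_det_no_slack K X c e s : (0 < n)%N -> max_det_ellipsoid K X c ->
  s < 1 -> ~ (forall x, K x -> inner (X *m (x - e)) (x - e) <= s).
Proof.
(* The maximum with 1/2 makes the bound positive, hence invertible, while keeping it below 1. *)
move=> n0 [pX _ maxX] s1 H; pose s' := Num.max s 2^-1.
have s'0 : 0 < s' by rewrite lt_max invr_gt0 ltr0n orbT.
have s'1 : s' < 1 by rewrite gt_max s1 invf_lt1// ltr1n.
have : \det (s'^-1 *: X) <= \det X.
  apply: (maxX _ e); first by apply: posdefmxZ => //; rewrite invr_gt0.
  move=> x /H xs; rewrite /ellipsoid /= -scalemxAl innerZl mulrC.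
  by rewrite ler_pdivrMr// mul1r (le_trans xs)// le_max lexx.
rewrite detZ -[leRHS]mul1r ler_pM2r ?posdefmx_det// leNgt => /negP; apply.
by rewrite exprn_egt1 -?lt0n// invf_gt1.
Qed.

(** Both ellipsoids are averaged into E(Z, e), which still contains K. Strict concavity of log det
    gives X = Y = Z; different centers would then leave slack. *)
Lemma max_det_unique K X Y c d : K !=set0 -> max_det_ellipsoid K X c ->
  posdefmx Y -> K `<=` ellipsoid Y d -> \det Y = \det X -> Y = X /\ d = c.
Proof.
move=> [k Kk] [pX KX maxX] pY KY YX.
pose Z := 2^-1 *: (X + Y).
have half : 2^-1 + 2^-1 = 1 :> R by lra.
have ZD : Z + Z = X + Y.
  by rewrite /Z -scalerDl half scale1r.
have pZ : posdefmx Z by apply: posdefmxZ; [rewrite invr_gt0|exact: posdefmxD].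
have uZ := posdefmx_unit pZ.
(* [e] minimizes the sum of the two quadratics, so the terms linear in x - e cancel. *)
pose e := 2^-1 *: (invmx Z *m (X *m c + Y *m d)).
have cross : X *m (e - c) + Y *m (e - d) = 0.
  rewrite !mulmxBr addrACA -mulmxDl -ZD -opprD mulmxDl /e -!scalemxAr mulKVmx//.
  by rewrite -scalerDl half scale1r subrr.
(* Half the minimal value of that sum, which is the slack of K in E(Z, e); it vanishes only if e = c
   = d. *)
pose r := 2^-1 * (inner (X *m (e - c)) (e - c) + inner (Y *m (e - d)) (e - d)).
have KZ x : K x -> inner (Z *m (x - e)) (x - e) <= 1 - r.
  move=> Kx; have := KX _ Kx; have := KY _ Kx; rewrite /ellipsoid /=.
  rewrite (quadratic_centerE x d e (proj1 pY)) (quadratic_centerE x c e (proj1 pX)).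
  have : inner (X *m (e - c)) (x - e) + inner (Y *m (e - d)) (x - e) = 0.
    by rewrite -innerDl cross /inner trmx0 mul0mx mxE.
  rewrite /Z -scalemxAl mulmxDl innerZl innerDl /r; lra.
have r0 : 0 <= r.
  by rewrite mulr_ge0 ?invr_ge0// addr_ge0// posdefmx_ge0.
have dZX : \det Z <= \det X.
  apply: (maxX _ e pZ) => x /KZ; rewrite /ellipsoid /=; lra.
have XY : X = Z.
  have [leX eqX] := posdefmx_det_tangent pX pZ.
  have [leY _] := posdefmx_det_tangent pY pZ.
  apply/eqP; rewrite -eqX eq_le leX /= leNgt; apply/negP => ltX.
  have dX := posdefmx_det pX; have dZ := posdefmx_det pZ.
  move: leY ltX; rewrite YX.
  set E1 := expR (\tr (_ *m Y) - _); set E2 := expR _ => leY ltX.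
  (* The traces of Z^-1 X and Z^-1 Y add up to tr (Z^-1 (2 Z)) = 2 n. Multiplying the tangent bounds
     at Z thus gives (det X)^2 < (det Z)^2, against maximality. *)
  have E12 : E1 * E2 = 1.
    rewrite /E1 /E2 -expRD -[RHS]expR0; congr expR.
    rewrite addrACA -linearD /= -mulmxDr [Y + X]addrC -ZD mulmxDr mulVmx//.
    by rewrite linearD /= mxtrace1; ring.
  have E20 : 0 < E2 by exact: expR_gt0.
  have : \det X * \det X < (\det Z * E1) * (\det Z * E2).
    apply: (@lt_le_trans _ _ (\det X * (\det Z * E2))); first by rewrite ltr_pM2l.
    by rewrite ler_pM2r// mulr_gt0.
  rewrite mulrACA E12 mulr1; apply/negP; rewrite -leNgt.
  by rewrite ler_pM// ltW.
have YXe : Y = X.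
  apply: (addrI X); rewrite -ZD -XY//.
split=> //; apply/eqP; apply: contraT => dc.
have n0 : (0 < n)%N.
  rewrite lt0n; apply: contra dc => /eqP n0; apply/eqP/colP => -[i ilt].
  by exfalso; move: ilt; rewrite n0.
have r1 : 1 - r < 1.
  rewrite ltrBlDr ltrDl lt_neqAle r0 andbT eq_sym; apply: contra dc.
  rewrite /r mulf_eq0 invr_eq0 pnatr_eq0 /= paddr_eq0 ?posdefmx_ge0//.
  have q0 (T : 'M[R]_n) w : posdefmx T -> inner (T *m w) w == 0 -> w = 0.
    by move=> [_ pT]; have [//|/pT q1 q2] := eqVneq w 0; rewrite (eqP q2) ltxx in q1.
  move=> /andP[/(q0 _ _ pX)/eqP + /(q0 _ _ pY)/eqP].
  by rewrite !subr_eq0 => /eqP <- /eqP <-.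
have mX : max_det_ellipsoid K X c by [].
case: (max_det_no_slack n0 mX r1 (e := e)) => x /KZ.
by rewrite -XY.
Qed.

Lemma aut_setV K g : aut_set K g -> aut_set K (- (invmx g.2 *m g.1), invmx g.2).
Proof.
move=> [ug gK]; split; first by rewrite unitmx_inv.
rewrite -[in LHS]gK image_comp (_ : _ \o _ = id) ?image_id//.
by apply/funext => x; rewrite /= /aff /= mulmxDr addKr mulKmx.
Qed.

(** Since g K = K, the pullback of E(X, c) under g contains K; its determinant is (det A)^2 det X,
    and maximality bounds it. *)
Lemma max_det_aut_det K X c g : max_det_ellipsoid K X c -> aut_set K g ->
  K `<=` ellipsoid (g.2^T *m X *m g.2) (invmx g.2 *m (c - g.1)) /\
  \det g.2 ^+ 2 <= 1.
Proof.
move=> [pX KX maxX] [ug gK].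
have KY : K `<=` ellipsoid (g.2^T *m X *m g.2) (invmx g.2 *m (c - g.1)).
  move=> x Kx; have /KX : K (aff g x) by rewrite -gK; exists x.
  rewrite /ellipsoid /=; have -> : aff g x - c =  g.2 *m (x - invmx g.2 *m (c - g.1)).
    by rewrite mulmxBr mulKVmx// opprB /aff addrA [_ + g.1]addrC.
  by move=> qx; rewrite -!mulmxA inner_mulmxl trmxK.
split=> //; have := maxX _ _ (posdefmx_congr pX ug) KY.
rewrite !det_mulmx det_tr mulrAC -expr2 -[leRHS]mul1r.
by rewrite ler_pM2r// posdefmx_det.
Qed.

(** The determinant bound for g and for its inverse gives (det A)^2 = 1, so the pullback of E(X, c)
    is again maximal and uniqueness identifies both matrix and center. *)
Lemma max_det_aut K X c g : K !=set0 -> max_det_ellipsoid K X c -> aut_set K g ->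
  [/\ g.2^T *m X *m g.2 = X, aff g c = c & `|\det g.2| = 1].
Proof.
move=> K0 mX gK; have [pX _ _] := mX; have [ug _] := gK.
have [KY le1] := max_det_aut_det mX gK.
have [_] := max_det_aut_det mX (aut_setV gK); rewrite /= det_inv exprVn => ge1.
have d0 : 0 < \det g.2 ^+ 2 by rewrite exprn_even_gt0// -unitfE -unitmxE.
have d1 : \det g.2 ^+ 2 = 1.
  by apply/eqP; rewrite eq_le le1 -invf_le1.
have [||-> dc] := max_det_unique K0 mX _ KY.
- exact: posdefmx_congr.
- by rewrite !det_mulmx det_tr mulrAC -expr2 d1 mul1r.
split=> //; first by rewrite /aff -dc mulKVmx// addrC subrK.
apply/eqP; rewrite -(@eqrXn2 _ 2)// expr1n real_normK ?num_real//.
by rewrite d1.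
Qed.

(** Absence of slack puts one extreme point on the boundary of E(X, c); transitivity and invariance
    of the form carry this to all of them. *)
Lemma max_det_contact K X c : (0 < n)%N -> K !=set0 -> compact K ->
  davies_symmetric K -> max_det_ellipsoid K X c ->
  forall y, extreme_points K y -> inner (X *m (y - c)) (y - c) = 1.
Proof.
move=> n0 K0 cK symK mX; have [pX KX _] := mX.
have [z ez zmax] := extreme_quadratic_max c 0 K0 cK pX.
have i0 (w : 'cV[R]_n) : inner 0 w = 0 by rewrite /inner trmx0 mul0mx mxE.
have qz : inner (X *m (z - c)) (z - c) = 1.
  apply/eqP; rewrite eq_le; apply/andP; split; first by apply: KX; case: ez.
  rewrite leNgt; apply/negP => /(max_det_no_slack n0 mX); apply => x /zmax.
  by rewrite /= !i0 !addr0; apply.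
move=> y /(symK _ _ ez)[g gz].
have [AXA gc _] := max_det_aut K0 mX (set_valP g).
rewrite -gz -gc -[RHS]qz -[in RHS]AXA -!mulmxA [in RHS]inner_mulmxl trmxK.
rewrite (_ : aff _ z - aff _ c = (val g).2 *m (z - c))//.
by rewrite /aff opprD addrACA subrr add0r -mulmxBr.
Qed.

Lemma aut_fixed_point_unique K X c b : convex_body K ->
  davies_symmetric K -> max_det_ellipsoid K X c ->
  (forall g, aut_set K g -> aff g b = b) -> b = c.
Proof.
move=> [cK _ [p /nbhs_ballP[e /= e0 pK]]] symK mX fixb.
have Kp : K p by apply: pK; exact: ballxx.
have K0 : K !=set0 by exists p.
have [pX KX _] := mX; pose v := X *m (b - c).
have [z ez _] := extreme_quadratic_max c 0 K0 cK pX.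
(* A fixes b - c because g fixes both points; with A^T X A = X this gives A^T v = v. *)
have lext y : extreme_points K y -> inner v y = inner v z.
  move=> /(symK _ _ ez)[g <-].
  have [AXA gc _] := max_det_aut K0 mX (set_valP g).
  have bc : (val g).2 *m (b - c) = b - c.
    by rewrite -[in RHS](fixb _ (set_valP g)) -[in RHS]gc /aff opprD addrACA subrr add0r -mulmxBr.
  apply/eqP; rewrite -subr_eq0 -innerNr -innerDr.
  have -> : aff (val g) z - z = (aff (val g) z - c) - (z - c).
    by rewrite opprB addrA subrK.
  rewrite -[in X in inner _ (X - _)]gc.
  have -> : aff (val g) z - aff (val g) c = (val g).2 *m (z - c).
    by rewrite /aff opprD addrACA subrr add0r -mulmxBr.
  have vA : (val g).2^T *m v = v by rewrite /v -[in LHS]bc !mulmxA AXA.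
  by rewrite innerDr innerNr [inner v (_ *m _)]innerC inner_mulmxl vA innerC subrr.
(* Adding t times the functional to the form of X gives a bound on the extreme points, hence on K.
   As the form is nonnegative, t (<v, y> - <v, z>) <= 1 for every real t; t = 2 / (<v, y> - <v, z>)
   is a contradiction. *)
have lK y : K y -> inner v y = inner v z.
  move=> Ky; apply/eqP; rewrite -subr_eq0; apply: contraT => l0.
  have H t : t * (inner v y - inner v z) <= 1.
    have := @quadratic_le_extreme _ _ K X c (t *: v) (1 + t * inner v z) cK pX _ y Ky.
    rewrite !innerZl => /(_ _)H.
    have : inner (X *m (y - c)) (y - c) + t * inner v y <= 1 + t * inner v z.
      apply: H => w ew; rewrite innerZl lext// lerD2r.
      by apply: KX; case: ew.
    by have := posdefmx_ge0 (y - c) pX; lra.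
  by have := H (2 / (inner v y - inner v z)); rewrite divfK//; lra.
have v0 : v = 0.
  apply/eqP; rewrite -inner_eq0.
  have [C C0 HC] : exists2 C : R, 0 < C & forall i, `|v i 0| < C.
    exists (1 + \sum_i `|v i 0|); first by rewrite ltr_pwDl// sumr_ge0.
    move=> i; rewrite (bigD1 i)//= addrCA ltrDl ltr_pwDl// sumr_ge0//.
  (* This step from the interior point [p] stays in the sup-norm ball, and constancy along it gives
     <v, v> = 0. *)
  have Kpv : K (p + (e / C) *: v).
    apply: pK; split=> // i j; rewrite ord1 mxE [(_ *: v) _ _]mxE /ball /=.
    rewrite opprD addrA subrr sub0r normrN.
    by rewrite normrM gtr0_norm ?divr_gt0// mulrAC ltr_pdivrMr// ltr_pM2l.
  have := lK _ Kpv; rewrite innerDr lK// innerZr => /eqP.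
  rewrite -subr_eq0 addrAC subrr add0r mulf_eq0 => /orP[|//].
  by rewrite gt_eqF// divr_gt0.
by apply/eqP; rewrite -subr_eq0 -(mulKmx (posdefmx_unit pX) (b - c)) -/v v0 mulmx0.
Qed.

End Maximality.

(** * First-order optimality condition *)

Section FirstOrder.
Variables (R : realType) (n : nat).
Implicit Types (K : set 'cV[R]_n) (c : 'cV[R]_n) (X D : 'M[R]_n).

(* t |-> tr (adj (X + t D) D), a polynomial in t so that its continuity at 0
   is at hand; it is det (X + t D) tr ((X + t D)^-1 D) where X + t D is
   invertible. *)
Lemma trace_adj_poly X D : exists P : {poly R},
  forall t, P.[t] = \tr (\adj (X + t *: D) *m D).
Proof.
pose Xp := map_mx polyC X + 'X *: map_mx polyC D.
exists (\tr (\adj Xp *m map_mx polyC D)) => t.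
have hC (A : 'M[R]_n) : map_mx (horner_eval t) (map_mx polyC A) = A.
  by apply/matrixP => i j; rewrite !mxE /= /horner_eval hornerC.
rewrite -[LHS]/(horner_eval t _) -trace_map_mx map_mxM map_mx_adj hC.
by rewrite map_mxD map_mxZ !hC /= /horner_eval hornerX.
Qed.

(** With Y = X + t D, E(Y, c) contains K, so det Y <= det X. The tangent bound at Y then gives tr
    (Y^-1 X) >= n, that is t tr (Y^-1 D) <= 0. Letting t tend to 0 from both sides forces the trace
    to vanish at X. *)
Lemma max_det_first_order K X c D : compact K -> max_det_ellipsoid K X c ->
  D^T = D ->
  (forall z, extreme_points K z -> inner (D *m (z - c)) (z - c) = 0) ->
  \tr (invmx X *m D) = 0.
Proof.
move=> cK [pX KX maxX] sD extD.
have [e e0 pXD] := posdefmx_perturb pX sD.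
have adjE Y : posdefmx Y ->
    \tr (\adj Y *m D) = \det Y * \tr (invmx Y *m D).
  move=> pY; rewrite /invmx posdefmx_unit// -scalemxAl linearZ /= mulrA mulfV ?mul1r//.
  by rewrite gt_eqF// posdefmx_det.
have trD t : `|t| < e -> t * \tr (\adj (X + t *: D) *m D) <= 0.
  move=> te; have pY := pXD t te; set Y := X + t *: D in pY *.
  have KY : K `<=` ellipsoid Y c.
    have i0 (w : 'cV[R]_n) : inner 0 w = 0 by rewrite /inner trmx0 mul0mx mxE.
    move=> y Ky; have := @quadratic_le_extreme _ _ K Y c 0 1 cK pY _ y Ky.
    rewrite /ellipsoid /= !i0 !addr0; apply => z ez; rewrite i0 addr0.
    rewrite mulmxDl innerDl -scalemxAl innerZl extD// mulr0 addr0.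
    by apply: KX; case: ez.
  have dY := posdefmx_det pY.
  rewrite adjE// mulrCA pmulr_rle0//.
  have [tangent _] := posdefmx_det_tangent pX pY.
  have : 1 <= expR (\tr (invmx Y *m X) - n%:R).
    rewrite -(ler_pM2l dY) mulr1; apply: le_trans tangent; exact: maxX KY.
  rewrite -[X in X <= _]expR0 ler_expR.
  have -> : X = Y - t *: D by rewrite addrK.
  rewrite mulmxBr mulVmx ?posdefmx_unit// linearB /= mxtrace1 -scalemxAr linearZ /=.
  by rewrite addrAC subrr add0r oppr_ge0.
have [P PE] := trace_adj_poly X D.
suff P0 : P.[0] = 0.
  move: P0; rewrite PE scale0r addr0 adjE// => /eqP.
  by rewrite mulf_eq0 gt_eqF ?posdefmx_det//= => /eqP.
apply/eqP; apply: contraT => P0.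
have Q0 : 0 < P.[0] * P.[0] by rewrite -expr2 exprn_even_gt0.
have : \forall t \near (0 : R), 0 < P.[t] * P.[0].
  have cP : P.[t] * P.[0] @[t --> (0 : R)] --> P.[0] * P.[0].
    by apply: cvgM; [exact: continuous_horner|exact: cvg_cst].
  exact: cvgr_gt cP _ Q0.
move=> /nbhs_ballP[d /= d0 dP].
pose a := `|P.[0]|; have a0 : 0 < a by rewrite normr_gt0.
(* The value t = s P(0) has the sign of P(0) and absolute value min (d, e) / 2; there t P(t) > 0,
   which contradicts [trD]. *)
pose s := Num.min d e / (2 * a).
have m0 : 0 < Num.min d e by rewrite lt_min d0 e0.
have s0 : 0 < s by rewrite divr_gt0// mulr_gt0.
have sP : `|s * P.[0]| = Num.min d e / 2.
  by rewrite normrM gtr0_norm// /s -/a -mulrA invfM -mulrA mulVf ?mulr1// gt_eqF.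
have m2 : Num.min d e / 2 < Num.min d e by lra.
have sd : `|s * P.[0]| < d by rewrite sP (lt_le_trans m2)// ge_min lexx.
have se : `|s * P.[0]| < e by rewrite sP (lt_le_trans m2)// ge_min lexx orbT.
have := trD _ se; rewrite -PE -mulrA pmulr_rle0// mulrC leNgt => /negP; case.
by apply: dP; rewrite /ball /= sub0r normrN.
Qed.

End FirstOrder.

(** * Real integrals of sums and under measure-preserving maps *)

Section Integrals.
Context d (T : measurableType d) (R : realType).
Variable mu : {measure set T -> \bar R}.

Lemma Rintegral_sum I (s : seq I) (D : set T) (f : I -> T -> R) :
  measurable D -> (forall i, mu.-integrable D (EFin \o f i)) ->
  \int[mu]_(x in D) (\sum_(i <- s) f i x) = \sum_(i <- s) \int[mu]_(x in D) f i x.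
Proof.
move=> mD intf; elim: s => [|i s IH].
  rewrite big_nil; under eq_Rintegral do rewrite big_nil.
  by rewrite Rintegral_cst// mul0r.
rewrite big_cons -IH -RintegralD//.
  by apply: eq_Rintegral => x _; rewrite big_cons.
rewrite (_ : _ \o _ = fun x => (\sum_(i <- s) (f i x)%:E)%E); last first.
  by apply/funext => x; rewrite /= sumEFin.
by apply: integrable_sum => // j _; exact: intf.
Qed.

Lemma bounded_le_integrable (D : set T) (f : T -> R) (C : R) : measurable D ->
  (mu D < +oo)%E -> measurable_fun D f -> (forall x, D x -> `|f x| <= C) ->
  mu.-integrable D (EFin \o f).
Proof.
move=> mD muD mf fC; apply: measurable_bounded_integrable => //.
by exists C; split; rewrite ?num_real// => B CB x Dx; exact: le_trans (fC _ Dx) (ltW CB).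
Qed.

Lemma Rintegral_preserving (phi : T -> T) (D : set T) (f : T -> R) :
  measurable_fun setT phi -> measurable D -> phi @^-1` D = D ->
  (forall B, measurable B -> mu (phi @^-1` B) = mu B) ->
  measurable_fun setT f -> mu.-integrable D (EFin \o f) ->
  mu.-integrable D (EFin \o (f \o phi)) ->
  \int[mu]_(x in D) f (phi x) = \int[mu]_(x in D) f x.
Proof.
move=> mphi mD phiD phimu mf intf intfphi; rewrite /Rintegral; congr fine.
transitivity (\int[pushforward mu phi]_(x in D) (f x)%:E)%E; last first.
  apply: (@eq_measure_integral _ _ _ D mu
    (measure_function_pushforward__canonical__measure_function_Measure mu mphi)).
  by move=> A mA _; exact: phimu.
by rewrite (integral_pushforward mphi) ?phiD//; exact/measurable_EFinP.
Qed.

End Integrals.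

(** * Invariance of the center of gravity *)

Section CenterOfGravity.
Variables (R : realType) (n : nat) (K : set 'cV[R]_n).
Hypothesis convK : convex_body K.

Lemma convex_body_measurable : measurable (K : set (Borel 'cV[R]_n)).
Proof. by case: convK => cK _ _; exact: measurable_compact. Qed.

Lemma convex_body_volume : exists2 v : R, 0 < v & volume K = v%:E.
Proof.
have mK := convex_body_measurable.
have [cK _ [p /nbhs_ballP[e /= e0 pK]]] := convK.
have [C C0 KC] := compact_coord_bounded cK.
have Kfin := volume_lt_pinfty C0 mK KC; have K0 := volume_gt0 e0 mK pK.
exists (fine (volume K)); first by rewrite fine_gt0// K0.
by rewrite fineK// ge0_fin_numE// ltW.
Qed.

(** As g preserves both K and Lebesgue measure, the integral of x over K equals that of a + A x,
    which is vol(K) a plus A applied to the former; dividing by vol(K) gives the claim. *)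
Lemma center_of_gravity_aut g : aut_set K g -> `|\det g.2| = 1 ->
  aff g (center_of_gravity K) = center_of_gravity K.
Proof.
case: g => a A [/= uA gK] detA.
have mK := convex_body_measurable; have [v v0 vE] := convex_body_volume.
have [cK _ _] := convK; have [C C0 KC] := compact_coord_bounded cK.
have Kfin : (lebesgue R n K < +oo)%E by rewrite -/(volume K) vE ltry.
have mcoord i := @measurable_coord R n i.
have intc i : (lebesgue R n).-integrable K (EFin \o (fun x : 'cV[R]_n => x i 0)).
  apply: (bounded_le_integrable mK Kfin (C := C)) => [|x Kx].
    exact: measurable_funS (mcoord i).
  by rewrite ltW// KC.
have intp i : (lebesgue R n).-integrable K
    (EFin \o (fun x : 'cV[R]_n => aff (a, A) x i 0)).
  apply: (bounded_le_integrable mK Kfin (C := C)) => [|x Kx].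
    apply: (@measurable_funS _ _ _ _ setT) => //.
    exact: (measurableT_comp (mcoord i) (measurable_aff (a, A))).
  by rewrite ltW// KC// -gK; exists x.
have gKV : aff (a, A) @^-1` K = K.
  apply/seteqP; split=> x; last by move=> Kx; rewrite /= -gK; exists x.
  rewrite /= -{1}gK => -[y Ky] /addrI /(can_inj (mulKmx uA)) <- //.
have inv i : \int[lebesgue R n]_(x in K) (aff (a, A) x i 0) =
    \int[lebesgue R n]_(x in K) ((x : 'cV[R]_n) i 0).
  apply: (@Rintegral_preserving _ (Borel 'cV[R]_n) R (lebesgue R n)
      (aff (a, A)) K (fun x : 'cV[R]_n => x i 0)) => //.
    exact: measurable_aff.
    by move=> B mB; rewrite scales_lebesgue_unitmx// detA invr1 mul1e.
  exact: (intp i).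
rewrite /center_of_gravity vE /= /aff /=; apply/colP => i; rewrite !mxE.
under eq_bigr do rewrite !mxE.
rewrite -[in RHS]inv.
have -> : \int[lebesgue R n]_(x in K) (aff (a, A) x i 0) =
    a i 0 * v + \sum_j A i j * \int[lebesgue R n]_(x in K) ((x : 'cV[R]_n) j 0).
  rewrite (@eq_Rintegral _ _ _ (lebesgue R n) K (fun x : Borel 'cV[R]_n =>
    a i 0 + \sum_j A i j * (x : 'cV[R]_n) j 0)); last first.
    by move=> x _; rewrite /aff !mxE.
  have intA j : (lebesgue R n).-integrable K
      (EFin \o (fun x : 'cV[R]_n => A i j * x j 0)).
    exact: (integrableZl mK (A i j) (intc j)).
  rewrite RintegralD//; first last.
  - rewrite (_ : _ \o _ = fun x : 'cV[R]_n => (\sum_j (A i j * x j 0)%:E)%E); last first.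
      by apply/funext => x; rewrite /= sumEFin.
    by apply: integrable_sum => // j _; exact: intA.
  - apply: (bounded_le_integrable mK Kfin (C := `|a i 0|)) => //.
  rewrite Rintegral_cst// -/(volume K) vE /= Rintegral_sum//; congr (_ + _).
  by apply: eq_bigr => j _; rewrite RintegralZl.
rewrite mulrDr mulrCA mulVf ?gt_eqF// mulr1; congr (_ + _).
by rewrite mulr_sumr; apply: eq_bigr => j _; rewrite mulrCA.
Qed.

End CenterOfGravity.

(** * The Haar average *)

Section AutGroup.
Variables (R : realType) (n : nat) (K : set 'cV[R]_n).

Lemma continuous_mulmxl m p q (A : 'M[R]_(m, p)) :
  continuous (fun B : 'M[R]_(p, q) => A *m B).
Proof.
rewrite (_ : (fun B => _) = fun B : 'M[R]_(p, q) =>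
    \sum_i \sum_j B i j *: (A *m delta_mx i j)); last first.
  apply/funext => B; rewrite {1}(matrix_sum_delta B) mulmx_sumr.
  apply: eq_bigr => i _; rewrite mulmx_sumr; apply: eq_bigr => j _.
  by rewrite -scalemxAr.
apply: continuous_big => [|i _]; first exact: add_continuous.
apply: continuous_big => [|j _]; first exact: add_continuous.
move=> B; apply: (@continuous_comp _ _ _ (fun B : 'M[R]_(p, q) => B i j)
  (fun r : R => r *: (A *m delta_mx i j))).
  exact: coord_continuous.
exact: scalel_continuous.
Qed.

Lemma continuous_aff_mul (h : 'cV[R]_n * 'M[R]_n) : continuous (aff_mul h).
Proof.
move=> g.
have c1 : continuous (fun g : 'cV[R]_n * 'M[R]_n => h.1 + h.2 *m g.1).
  move=> {}g; apply: (@continuousD _ 'cV[R]_n _ (fun=> h.1)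
    ((fun v : 'cV[R]_n => h.2 *m v) \o fst)); first exact: cst_continuous.
  by apply: continuous_comp; [exact: cvg_fst|exact: continuous_mulmxl].
have c2 : continuous (fun g : 'cV[R]_n * 'M[R]_n => h.2 *m g.2).
  move=> {}g; apply: (@continuous_comp _ _ _ snd (fun B : 'M[R]_n => h.2 *m B)).
    exact: cvg_snd.
  exact: continuous_mulmxl.
exact: (cvg_pair (c1 g) (c2 g)).
Qed.

Lemma measurable_aut_mul (h : Aut K) :
  measurable_fun setT (aut_mul h : Borel (Aut K) -> Borel (Aut K)).
Proof.
apply: (@measurability _ _ _ (Borel (Aut K)) _ _ (@open (Aut K))) => //.
move=> _ [_ [U oU <-] <-]; rewrite setTI; apply: sub_sigma_algebra.
exists (aff_mul (val h) @^-1` U) => //.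
by move/continuousP: (@continuous_aff_mul (val h)); apply.
Qed.

Lemma measurable_linear_part i j :
  measurable_fun setT (fun g : Borel (Aut K) => linear_part g i j).
Proof.
apply: (measurability _ (RGenOpens.measurableE R)).
move=> _ [_ [a [b ->] <-]]; rewrite setTI; apply: sub_sigma_algebra.
exists ((fun g : 'cV[R]_n * 'M[R]_n => g.2 i j) @^-1` `]a, b[%classic) => //.
have /continuousP : continuous (fun g : 'cV[R]_n * 'M[R]_n => g.2 i j).
  move=> g; apply: (@continuous_comp _ _ _ snd (fun B : 'M[R]_n => B i j)).
    exact: cvg_snd.
  exact: coord_continuous.
by apply; exact: interval_open.
Qed.

Definition aut_inv (g : Aut K) : Aut K := SigSub (mem_set (aut_setV (set_valP g))).

Lemma aut_mulV g h : aut_mul g (aut_mul (aut_inv g) h) = h.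
Proof.
have [ug _] := set_valP g; apply/val_inj => /=; rewrite /aff_mul /=.
by rewrite mulmxDr mulmxN !mulKVmx// addNKr -surjective_pairing.
Qed.

Lemma aut_mulVK g h : aut_mul (aut_inv g) (aut_mul g h) = h.
Proof.
have [ug _] := set_valP g; apply/val_inj => /=; rewrite /aff_mul /=.
by rewrite mulmxDr !mulKmx// addKr -surjective_pairing.
Qed.

Lemma haar_translate (mu : probability (Borel (Aut K)) R) (h : Aut K)
    (f : Aut K -> R) (C : R) : haar_probability mu ->
  measurable_fun setT (f : Borel (Aut K) -> R) -> (forall g, `|f g| <= C) ->
  \int[mu]_g f (aut_mul h g) = \int[mu]_g f g.
Proof.
move=> haar mf fC.
have mu1 : (mu setT < +oo)%E by rewrite probability_setT ltry.
apply: (@Rintegral_preserving _ (Borel (Aut K)) R mu (aut_mul h) setT f) => //.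
- exact: measurable_aut_mul.
(* Invariance is stated for images, so the preimage under translation by [h] is written as the image
   under translation by its inverse. *)
- move=> B mB; apply: etrans (haar (aut_inv h) B mB); congr (mu _).
  apply/seteqP; split=> g /=.
    by move=> Bg; exists (aut_mul h g) => //; rewrite aut_mulVK.
  by move=> [g' Bg' <-]; rewrite aut_mulV.
- by apply: (bounded_le_integrable measurableT mu1 mf (C := C)).
- apply: (bounded_le_integrable measurableT mu1 _ (C := C)) => //.
    exact: (measurableT_comp mf (measurable_aut_mul h)).
  by move=> g _; exact: fC.
Qed.

End AutGroup.

(** * Quadratic forms averaged over Aut(K) *)

Section HaarAverage.
Variables (R : realType) (n : nat) (K : set 'cV[R]_n) (X : 'M[R]_n).
Variable c : 'cV[R]_n.
Hypotheses (K0 : K !=set0) (maxX : max_det_ellipsoid K X c).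
Let W (g : Aut K) := invmx (linear_part g).

Lemma aut_unit (g : Aut K) : linear_part g \in unitmx.
Proof. by case: (set_valP g). Qed.

Lemma aut_congr (g : Aut K) : (W g)^T *m X *m W g = X.
Proof. by have [] := max_det_aut K0 maxX (set_valP (aut_inv g)). Qed.

(** Invariance of X makes A^-1 linear in the entries of A, which gives measurability of the
    inverse. *)
Lemma aut_invE (g : Aut K) : W g = invmx X *m (linear_part g)^T *m X.
Proof.
have uX : X \in unitmx by case: maxX => /posdefmx_unit.
have [AXA _ _] := max_det_aut K0 maxX (set_valP g).
have AX : (linear_part g)^T *m X = X *m W g.
  by rewrite -[X in X *m W g]AXA mulmxK// aut_unit.
by rewrite -mulmxA AX mulKmx.
Qed.

Lemma aut_congr_inv (g : Aut K) : W g *m invmx X *m (W g)^T = invmx X.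
Proof.
have uX : X \in unitmx by case: maxX => /posdefmx_unit.
have uW : W g \in unitmx by rewrite unitmx_inv aut_unit.
have WXW : invmx X *m (W g)^T *m X *m W g = 1%:M.
  by rewrite -!mulmxA [_ *m (X *m _)]mulmxA aut_congr mulVmx.
rewrite -!mulmxA; apply: (can_inj (mulKmx (_ : invmx (W g) \in unitmx))).
  by rewrite unitmx_inv.
rewrite mulKmx//; apply: (can_inj (mulmxK uX)).
apply: (can_inj (mulmxK uW)); rewrite WXW.
by rewrite -[invmx _ *m _ *m X]mulmxA mulVmx// mulmx1 mulVmx.
Qed.

Lemma measurable_aut_inv i j :
  measurable_fun setT (fun g : Borel (Aut K) => W g i j).
Proof.
rewrite (_ : (fun g => _) = fun g : Borel (Aut K) => \sum_k
   (\sum_l invmx X i l * linear_part g k l) * X k j); last first.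
  apply/funext => g; rewrite aut_invE mxE; apply: eq_bigr => k _; rewrite mxE.
  by congr (_ * _); apply: eq_bigr => l _; rewrite mxE.
apply: measurable_sum => k; apply: measurable_funM => //.
apply: measurable_sum => l; apply: measurable_funM => //.
exact: measurable_linear_part.
Qed.

(** Each A_g^-1 preserves the form of X, so coercivity bounds its columns uniformly in g. *)
Lemma aut_inv_bounded : exists C : R, forall g i j, `|W g i j| <= C.
Proof.
have [pX _ _] := maxX; have [C C0 HC] := posdefmx_coercive pX.
exists (1 + \sum_j C * inner (X *m delta_mx j 0) (delta_mx j 0)) => g i j.
pose e : 'cV[R]_n := delta_mx j 0.
have We : W g *m e = col j (W g) by rewrite colE.
have := HC (W g *m e).
have -> : inner (X *m (W g *m e)) (W g *m e) = inner (X *m e) e.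
  by rewrite [LHS]innerC [LHS]inner_mulmxl !mulmxA aut_congr innerC.
set q := inner (X *m e) e => le1.
have le2 : C * q <= \sum_j C * inner (X *m delta_mx j 0) (delta_mx j 0).
  rewrite (bigD1 j)//= lerDl sumr_ge0// => k _.
  by rewrite mulr_ge0 ?posdefmx_ge0// ltW.
have : `|W g i j| ^+ 2 <= inner (W g *m e) (W g *m e).
  rewrite real_normK ?num_real// We innerE (bigD1 i)//= !mxE expr2 lerDl.
  by rewrite sumr_ge0// => k _; rewrite -expr2 sqr_ge0.
move: le1 le2; have := normr_ge0 (W g i j); set u := `|_|; nra.
Qed.

Variables (mu : probability (Borel (Aut K)) R).

Lemma integrable_aut_inv_prod i j k l : mu.-integrable setT
  (EFin \o (fun g : Borel (Aut K) => W g i k * W g j l)).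
Proof.
have [C HC] := aut_inv_bounded.
have mu1 : (mu setT < +oo)%E by rewrite probability_setT ltry.
apply: (bounded_le_integrable measurableT mu1 (C := C * C)) => [|g _].
  by apply: measurable_funM; exact: measurable_aut_inv.
by rewrite normrM ler_pM.
Qed.

(* The (i, j) entry of the Haar average, as a quadratic form in the point. *)
Definition haar_form i j : 'M[R]_n :=
  \matrix_(k, l) \int[mu]_g (W g i k * W g j l).

Lemma haar_formE i j (w : 'cV[R]_n) : inner (haar_form i j *m w) w =
  \int[mu]_g ((W g *m w) i 0 * (W g *m w) j 0).
Proof.
have intw k l : mu.-integrable setT
    (EFin \o (fun g : Borel (Aut K) => w k 0 * w l 0 * (W g i k * W g j l))).
  exact: (integrableZl measurableT (w k 0 * w l 0) (integrable_aut_inv_prod i j k l)).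
transitivity (\int[mu]_g (\sum_(p : 'I_n * 'I_n)
    w p.1 0 * w p.2 0 * (W g i p.1 * W g j p.2))); last first.
  apply: eq_Rintegral => g _; rewrite !mxE big_distrlr /= pair_big /=.
  by apply: eq_bigr => p _; ring.
rewrite Rintegral_sum//.
rewrite innerE; under eq_bigr => k _ do rewrite mxE mulr_suml.
rewrite pair_big /=; apply: eq_bigr => -[k l] _ /=.
rewrite RintegralZl//; last exact: integrable_aut_inv_prod.
by rewrite mxE; ring.
Qed.

(** Under the integral the trace is the (j, i) entry of A_g^-1 X^-1 A_g^-T, which is constantly that
    of X^-1; [mu] has mass 1. *)
Lemma trace_haar_form i j : \tr (invmx X *m haar_form i j) = invmx X j i.
Proof.
have intp (p : 'I_n * 'I_n) : mu.-integrable setT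
    (EFin \o (fun g : Borel (Aut K) => invmx X p.1 p.2 * (W g i p.2 * W g j p.1))).
  exact: (integrableZl measurableT _ (integrable_aut_inv_prod i j p.2 p.1)).
transitivity (\int[mu]_g (\sum_(p : 'I_n * 'I_n)
    invmx X p.1 p.2 * (W g i p.2 * W g j p.1))).
  rewrite Rintegral_sum//.
  rewrite /mxtrace; under eq_bigr => k _ do rewrite mxE.
  rewrite pair_big /=; apply: eq_bigr => -[k l] _ /=.
  by rewrite RintegralZl ?mxE//; exact: integrable_aut_inv_prod.
transitivity (\int[mu]_(g in setT) invmx X j i); last first.
  rewrite Rintegral_cst// -[RHS]mulr1 -[X in _ = _ * X]/(fine 1%E).
  congr (_ * fine _); exact: probability_setT.
apply: eq_Rintegral => g _; rewrite -[in RHS](aut_congr_inv g) -mulmxA.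
rewrite mxE -(pair_big xpredT xpredT
  (fun k l => invmx X k l * (W g i l * W g j k))) /=.
apply: eq_bigr => k _; rewrite [in RHS]mxE mulr_sumr; apply: eq_bigr => l _.
by rewrite [X in _ = _ * (_ * X)]mxE; ring.
Qed.

End HaarAverage.

(** * Constancy of the averaged forms on extreme points *)

Section HaarDavies.
Variables (R : realType) (n : nat) (K : set 'cV[R]_n) (X : 'M[R]_n).
Variable c : 'cV[R]_n.
Hypotheses (K0 : K !=set0) (maxX : max_det_ellipsoid K X c).
Hypothesis symK : davies_symmetric K.
Variables (mu : probability (Borel (Aut K)) R).
Hypothesis haar : haar_probability mu.

(** If y = h x then y - c = A_h (x - c), and A_g^-1 A_h is the inverse linear part of h^-1 g, so
    left invariance absorbs h. *)
Lemma haar_form_extreme i j x y : extreme_points K x -> extreme_points K y ->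
  inner (haar_form mu i j *m (y - c)) (y - c) =
  inner (haar_form mu i j *m (x - c)) (x - c).
Proof.
move=> ex ey; have [h hxy] := symK ex ey.
have [C HC] := aut_inv_bounded K0 maxX.
have [_ hc _] := max_det_aut K0 maxX (set_valP h).
rewrite !(haar_formE K0 maxX).
pose f (g : Aut K) := (invmx (linear_part g) *m (x - c)) i 0 *
  (invmx (linear_part g) *m (x - c)) j 0.
pose B := \sum_k C * `|(x - c) k 0|.
have fB (g : Aut K) k : `|(invmx (linear_part g) *m (x - c)) k 0| <= B.
  rewrite mxE; apply: le_trans (ler_norm_sum _ _ _) _; apply: ler_sum => l _.
  by rewrite normrM ler_wpM2r//; exact: HC.
transitivity (\int[mu]_g f (aut_mul (aut_inv h) g)).
  apply: eq_Rintegral => g _; rewrite /f.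
  have -> : y - c = linear_part h *m (x - c).
    by rewrite -hxy -[in LHS]hc /aff opprD addrACA subrr add0r -mulmxBr.
  have -> : invmx (linear_part (aut_mul (aut_inv h) g)) =
      invmx (linear_part g) *m linear_part h.
    have uh := aut_unit h; have ug := aut_unit g.
    have uhg := aut_unit (aut_mul (aut_inv h) g).
    apply: (can_inj (mulKmx uhg)); rewrite mulmxV//.
    by rewrite {1}/linear_part /= -/(linear_part g) -/(linear_part h) !mulmxA mulmxK// mulVmx.
  by rewrite !mulmxA.
apply: (haar_translate (C := B * B) (aut_inv h) haar) => [|g].
  have mW k : measurable_fun setT (fun g : Borel (Aut K) =>
      (invmx (linear_part g) *m (x - c)) k 0).
    rewrite (_ : (fun g => _) = fun g : Borel (Aut K) =>
        \sum_l invmx (linear_part g) k l * (x - c) l 0); last first.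
      by apply/funext => g; rewrite mxE.
    apply: measurable_sum => l; apply: measurable_funM => //.
    exact: measurable_aut_inv K0 maxX k l.
  exact: measurable_funM.
by rewrite /f normrM ler_pM.
Qed.

End HaarDavies.

Theorem corollary4p11 (R : realType) (n : nat) (K : set 'cV[R]_n)
    (convK : convex_body K) (symK : davies_symmetric K)
    (X : 'M[R]_n) (c : 'cV[R]_n) (posX : posdefmx X)
    (CEK : min_volume_ellipsoid K (ellipsoid X c)) :
  c = center_of_gravity K /\
  forall (mu : probability (Borel (Aut K)) R) (x : 'cV[R]_n),
    haar_probability mu -> extreme_points K x ->
    invmx X = n%:R *: mxRintegral mu setT (fun g : Aut K =>
      invmx (linear_part g) *m (x - c) *m (x - c)^T
        *m (invmx (linear_part g))^T).
Proof.
have maxX := min_volume_max_det posX CEK.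
have [cK _ [p /interior_subset Kp]] := convK.
have K0 : K !=set0 by exists p.
split.
  apply/esym/(aut_fixed_point_unique convK symK maxX) => g Kg.
  by have [_ _ ?] := max_det_aut K0 maxX Kg; exact: center_of_gravity_aut.
move=> mu x haar ex.
(* In dimension 0 the matrix equation has no entries; the contact property holds in positive
   dimension. *)
have [n0|n0] := posnP n; first by apply/matrixP => i; have := ltn_ord i; rewrite {2}n0.
have contact := max_det_contact n0 K0 cK symK maxX.
have [sX _] := posX.
apply/matrixP => i j; rewrite !mxE.
pose N := haar_form mu i j; pose m := inner (N *m (x - c)) (x - c).
have -> : \int[mu]_g ((invmx (linear_part g) *m (x - c) *m (x - c)^T
    *m (invmx (linear_part g))^T) i j) = m.
  rewrite /m /N (haar_formE K0 maxX); apply: eq_Rintegral => g _.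
  by rewrite -mulmxA -trmx_mul mxE big_ord1 [in X in _ * X]mxE.
(* [N] may fail to be symmetric when i and j differ; symmetrizing changes neither its quadratic form
   nor its trace against X^-1. Subtracting m X makes the form of [D] vanish on the extreme
   points. *)
pose D := 2^-1 *: (N + N^T) - m *: X.
have sD : D^T = D.
  by rewrite /D linearB /= !linearZ /= linearD /= trmxK sX [N^T + N]addrC.
have extD z : extreme_points K z -> inner (D *m (z - c)) (z - c) = 0.
  move=> ez; rewrite /D mulmxBl innerDl innerNl -!scalemxAl !innerZl contact//.
  rewrite mulmxDl innerDl [inner (N^T *m _) _]inner_mulmxl trmxK.
  rewrite [inner (z - c) _]innerC /N (haar_form_extreme K0 maxX symK haar i j ex ez).
  by rewrite -/N -/m; lra.
have := max_det_first_order cK maxX sD extD.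
rewrite /D mulmxBr linearB /= -!scalemxAr !linearZ /= mulVmx ?posdefmx_unit//.
rewrite mxtrace1 mulmxDr linearD /=.
have -> : \tr (invmx X *m N^T) = \tr (invmx X *m N).
  by rewrite -mxtrace_tr trmx_mul trmxK trmx_inv sX mxtrace_mulC.
rewrite /N (trace_haar_form K0 maxX) -/N.
have -> : invmx X j i = invmx X i j by rewrite -[in RHS]sX -trmx_inv mxE.
by rewrite -[m *: _]/(m * - n%:R); lra.
Qed.
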